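(* Let $G$ be a $d$-regular finite simple graph with $d\ge \log_2|V(G)|\ge 8$. Then $\chi'_{vd}(G)\le k(G)+3$.
   Context: For an integer $k\ge 1$, an edge-$k$-coloring of a simple graph $G$ is an assignment of colors from $\{1,\ldots,k\}$ to the edges of $G$ such that adjacent edges receive distinct colors. For such a coloring $\varphi$ and a vertex $v$, $\varphi(v)$ denotes the set of colors on the edges incident with $v$. The coloring is vertex-distinguishing if $\varphi(u)\neq\varphi(v)$ for all distinct vertices $u,v$. For a graph with at most one isolated vertex and no isolated edge, $\chi'_{vd}(G)$ is the least $k$ for which $G$ has a vertex-distinguishing edge-$k$-coloring. For $d\in[\delta(G),\Delta(G)]$ let $n_d$ be the number of vertices of degree $d$, and $k(G)=\min\{k\in\mathbb{N}: \binom{k}{d}\ge n_d \text{ for all } d\in[\delta(G),\Delta(G)]\}$; for a $d$-regular graph on $n$ vertices this is the least $k$ with $\binom{k}{d}\ge n$. *)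

(* Defs.v *)
From mathcomp Require Import all_boot all_order all_algebra.
From mathcomp Require Import boolp reals exp.

Set Implicit Arguments.
Unset Strict Implicit.
Unset Printing Implicit Defensive.

Import GRing.Theory Num.Theory.

Definition log2 (R : realType) (x : R) : R := (ln x / ln 2)%R.

(* Minimum of a set of natural numbers; the value 0 on the empty set is junk,
   see [vd_indexP] and [kGP]. *)
Definition least (P : pred nat) : nat :=
  if pselect (exists n, P n) is left exP then ex_minn exP else 0.

Definition is_least (P : pred nat) (m : nat) : Prop :=
  P m /\ forall n, P n -> m <= n.

Lemma leastP (P : pred nat) : (exists n, P n) -> is_least P (least P).
Proof.
move=> exP; rewrite /least; case: pselect => [ex|//].
by case: ex_minnP.
Qed.

Record sgraph := SGraph {
  vertex :> finType;
  adj : rel vertex;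
  adj_sym : symmetric adj;
  adj_irr : irreflexive adj }.

Section Graph.
Variable G : sgraph.

Definition edges : {set {set G}} :=
  [set [set p.1; p.2] | p : G * G & adj p.1 p.2].

Definition incident (v : G) : {set {set G}} := [set a in edges | v \in a].

Definition degree (v : G) : nat := #|[set u | adj v u]|.

Definition maxdeg : nat := \max_(v : G) degree v.
(* Equal to 0 if G has no vertex. *)
Definition mindeg : nat := \big[minn/maxdeg]_(v : G) degree v.

Definition regular (d : nat) : Prop := forall v : G, degree v = d.

Definition ndeg (d : nat) : nat := #|[set v : G | degree v == d]|.

Section Coloring.
Variable k : nat.
(* A colouring is given by a function on all vertex sets, of which only the
   values on [edges] are ever used; this forces k >= 1. *)
Implicit Type c : {ffun {set G} -> 'I_k}.

Definition proper_coloring c : bool :=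
  [forall a in edges, forall b in edges,
    (a != b) && (a :&: b != set0) ==> (c a != c b)].

Definition palette c (v : G) : {set 'I_k} := [set c a | a in incident v].

Definition vd_coloring c : bool :=
  proper_coloring c &&
  [forall u : G, forall v : G, (u != v) ==> (palette c u != palette c v)].

End Coloring.

Definition vd_colorable (k : nat) : bool :=
  [exists c : {ffun {set G} -> 'I_k}, vd_coloring c].

Definition vd_index : nat := least vd_colorable.

Definition kG_bound (k : nat) : bool :=
  all (fun d => ndeg d <= 'C(k, d)) (index_iota mindeg maxdeg.+1).

Definition kG : nat := least kG_bound.

Definition isolated_edge (u v : G) : bool :=
  [&& adj u v, degree u == 1 & degree v == 1].

Definition vd_admissible : Prop :=
  ndeg 0 <= 1 /\ forall u v : G, ~~ isolated_edge u v.

Lemma incidentP v a :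
  reflect (exists2 u, adj v u & a = [set v; u]) (a \in incident v).
Proof.
rewrite inE; apply: (iffP andP) => [[/imsetP[[x y]]]|[u vu ->]].
  rewrite inE /= => xy -> /set2P[] ->; first by exists y.
  by exists x; [rewrite adj_sym|rewrite setUC].
split; last by rewrite set21.
by apply/imsetP; exists (v, u); rewrite ?inE.
Qed.

Lemma incident_isolated u v : u != v -> incident u = incident v ->
  degree u != 0 -> isolated_edge u v.
Proof.
have sub x y w : x != y -> incident x = incident y -> adj x w -> w = y.
  move=> xy E xw; have : [set x; w] \in incident y.
    by rewrite -E; apply/incidentP; exists w.
  by rewrite inE !inE => /andP[_ /orP[]/eqP yE]; rewrite yE ?eqxx // in xy *.
move=> uv E; rewrite -lt0n => /card_gt0P[w]; rewrite inE => uw.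
have wv := sub _ _ _ uv E uw; rewrite {}wv in uw.
have deg1 x y : x != y -> incident x = incident y -> adj x y -> degree x == 1.
  move=> xy Exy axy; apply/cards1P; exists y; apply/setP => z; rewrite !inE.
  apply/idP/eqP => [xz|->//]; exact: sub xy Exy xz.
rewrite /isolated_edge uw (deg1 _ _ uv E uw) (@deg1 v u) // 1?eq_sym //.
by rewrite adj_sym.
Qed.

Lemma vd_indexP : vd_admissible -> is_least vd_colorable vd_index.
Proof.
case=> n0 ne; apply: leastP; exists #|{set G}|; apply/existsP.
have injc : injective [ffun a : {set G} => enum_rank a].
  by move=> a b; rewrite !ffunE; apply: enum_rank_inj.
exists [ffun a => enum_rank a]; apply/andP; split.
  apply/forall_inP => a _; apply/forall_inP => b _; apply/implyP => /andP[ab _].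
  by apply: contra ab => /eqP /injc ->.
apply/forallP => u; apply/forallP => v; apply/implyP => uv; apply/negP => /eqP E.
have {}E : incident u = incident v by apply: (imset_inj injc).
case: (eqVneq (degree u) 0) => [du|du]; last first.
  by have := incident_isolated uv E du; apply/negP.
case: (eqVneq (degree v) 0) => [dv|dv]; last first.
  have vu : v != u by rewrite eq_sym.
  by have := incident_isolated vu (esym E) dv; apply/negP.
have : [set u; v] \subset [set v | degree v == 0].
  by apply/subsetP => x /set2P[] ->; rewrite inE ?du ?dv.
by move/subset_leq_card; rewrite cards2 uv => /leq_trans/(_ n0).
Qed.

Lemma bin_ge n d : 0 < d -> n < 'C(n + d, d).
Proof.
case: d => // d _; elim: n => [|n IH]; first by rewrite add0n binn.
rewrite addSn binS -addn1 leq_add //.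
by rewrite bin_gt0 addnS leqW // leq_addl.
Qed.

Lemma kGP : vd_admissible -> is_least kG_bound kG.
Proof.
case=> n0 _; apply: leastP; exists (#|G| + maxdeg); apply/allP => d.
rewrite mem_index_iota ltnS => /andP[_ dm].
have [->|d0] := posnP d; first by rewrite bin0.
apply: leq_trans (leq_bin2l _ (_ : #|G| + d <= _)); last by rewrite leq_add2l.
by apply: leq_trans (max_card _) _; apply/ltnW/bin_ge.
Qed.

Lemma regular_admissible d : 1 < d -> regular d -> vd_admissible.
Proof.
case: d => [|[|d]] // _ r; split=> [|u v].
  by rewrite /ndeg (_ : [set _ | _] = set0) ?cards0 //; apply/setP => v; rewrite !inE r.
by rewrite /isolated_edge r andbF.
Qed.

End Graph.

(* Main.v *)
Require Import Defs.
From mathcomp Require Import all_boot all_order all_algebra.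
From mathcomp Require Import reals.
From mathcomp Require Import perm boolp exp zify.

Set Implicit Arguments.
Unset Strict Implicit.
Unset Printing Implicit Defensive.

(* Idea.  Let [k = kG G].  Since d >= log2 n >= 8, we have 2k <= 3d.

   Take two colour classes of a (d+1)-edge colouring of G (Vizing), the first
   of them maximum.  After a Kempe change their union has no component with
   fewer than three vertices, and a minimal spanning subgraph h of it with this
   property is a linear forest.  At most 2n/3 vertices have degree 1 in h, so
   there are enough (d-1)-sets, and enough (d-2)-sets, of k-1 colours for the
   vertices of degree 1, and 2, in h.

   Colour G - h with k-1 colours so that the sum of the squares of the
   multiplicities of the palettes is minimum.  Kempe changes then show that the
   multiplicities of two palettes of the same size differ by at most 2, hence
   no palette occurs more than twice.

   Finally colour h with 4 new colours, edge by edge along its paths: an edge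
   has at most three forbidden colours, where a vertex whose last edge is
   being coloured must be distinguished from the only other vertex with
   the same palette in G - h.  This uses k + 3 colours. *)

(** * Pairs of involutions *)

(** Both conditions on [h] serve the last step. In a component with two vertices, both ends would
    get the same set of new colours, so two such ends with equal palettes in G - h could never be
    told apart. In a cycle, the edge coloured last completes both of its ends: two adjacent edges
    and two rivals could exclude all 4 new colours. In a forest, each edge can be coloured when it
    is a pendant edge of the part coloured so far, and then has at most one coloured adjacent edge.
    Multiplicity 2 is the target because it leaves a vertex at most one rival. Kempe changes only
    bound differences of multiplicities, so an average of at most 1 is needed within each palette
    size. For size d-1 this is where the fraction 2/3 meets 2k <= 3d: C(k-1, d-1) = (d/k) C(k, d) >=
    2n/3. In turn, 2k <= 3d rests on 2^d <= C(floor(3d/2), d), which fails for d = 7 (128 > 120) and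
    holds from d = 8 on. *)

Lemma exists_minimizer (T : Type) (P : T -> Prop) (f : T -> nat) :
  (exists x, P x) -> exists x, P x /\ forall y, P y -> f x <= f y.
Proof.
case=> x; move: {2}(f x) (leqnn (f x)) => m.
elim: m x => [|m IH] x fx Px.
  by exists x; split=> // y _; apply: leq_trans fx _.
have [[y [Py fy]]|no] := EM (exists y, P y /\ f y < f x).
  by apply: (IH y) => //; rewrite -ltnS (leq_trans fy).
exists x; split=> // y Py; rewrite leqNgt; apply/negP => fy.
by apply: no; exists y.
Qed.

Section TwoInvolutions.
Variable (V : finType) (kap mu : V -> V).
Hypotheses (kapK : involutive kap) (muK : involutive mu).

Definition inv_step : rel V := [rel u v | (v == kap u) || (v == mu u)].
Definition inv_conn : rel V := connect inv_step.
(** When [kap] and [mu] are two matchings, these are the ends of the alternating paths with at least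
    one edge; a vertex fixed by both is a component by itself. *)
Definition one_fixed (x : V) : bool := (kap x == x) (+) (mu x == x).

Lemma inv_conn_sym : symmetric inv_conn.
Proof.
apply: sym_connect_sym => u v; rewrite /inv_step /=.
by rewrite (eq_sym v) (inv_eq kapK) (eq_sym v (mu u)) (inv_eq muK).
Qed.

Lemma inv_conn_kap x y : inv_conn x (kap y) = inv_conn x y.
Proof.
apply/esym/(same_connect_r inv_conn_sym)/connect1.
by rewrite /inv_step /= eqxx.
Qed.

Lemma inv_conn_mu x y : inv_conn x (mu y) = inv_conn x y.
Proof.
apply/esym/(same_connect_r inv_conn_sym)/connect1.
by rewrite /inv_step /= eqxx orbT.
Qed.

End TwoInvolutions.

(** * The two ends of an alternating path *)

Section Endpoint.
Variable V : finType.
Implicit Types kap mu : V -> V.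

(* The component is the orbit of [x] under [kap \o mu], on which [mu] and
   [kap] act on exponents as i |-> -i and i |-> 1 - i. *)
Lemma endpoint_aux kap mu x : involutive kap -> involutive mu ->
  mu x = x -> kap x != x ->
  exists y, [/\ one_fixed kap mu y, y != x, inv_conn kap mu x y &
    forall z, inv_conn kap mu x z -> (kap z == z) || (mu z == z) ->
      z = x \/ z = y].
Proof.
move=> kapK muK mux kapx; pose p := kap \o mu.
have pI : injective p by apply: inj_comp; apply: can_inj; eassumption.
have itinj n : injective (iter n p) by elim: n => [|n IH] u v //= /pI/IH.
have pmu i : iter i p (mu (iter i p x)) = x.
  elim: i => [|i IH]; first by rewrite /= mux.
  rewrite iterSr [iter i.+1 p x]iterS.
  by rewrite [p (mu (p _))](_ : _ = mu (iter i p x)) // /p /= muK kapK.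
have pkap i : iter i p (kap (iter i p x)) = p x.
  have -> : kap (iter i p x) = p (mu (iter i p x)) by rewrite /p /= muK.
  by rewrite -iterSr iterS pmu.
set m := order p x.
have pm : iter m p x = x by apply: iter_order.
have mgt1 : 1 < m.
  rewrite ltnNge; apply/negP => m1.
  have m1' : m = 1 by apply/eqP; rewrite eqn_leq m1 order_gt0.
  by move: pm; rewrite m1' /= /p /= mux; apply/eqP.
have itI i j : i < m -> j < m -> iter i p x = iter j p x -> i = j.
  by move=> im jm E; rewrite -(findex_iter im) -(findex_iter jm) E.
have reduce j : m <= j -> iter j p x = iter (j - m) p x.
  by move=> mj; rewrite -[in LHS](subnK mj) iterD pm.
have fixmu i : i < m -> mu (iter i p x) = iter i p x -> i = 0 \/ i + i = m.
  move=> im E; have := pmu i; rewrite E -iterD => E2.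
  have [lt|ge] := ltnP (i + i) m.
    by left; have := itI (i + i) 0 lt (ltnW mgt1) E2; lia.
  right; rewrite reduce // in E2.
  by have := itI (i + i - m) 0 _ (ltnW mgt1) E2; lia.
have fixkap i : i < m -> kap (iter i p x) = iter i p x -> i + i = m.+1.
  move=> im E; have := pkap i; rewrite E -iterD => E2.
  have [lt|ge] := ltnP (i + i) m.
    by have := itI (i + i) 1 lt mgt1 E2; lia.
  rewrite reduce // in E2.
  by have := itI (i + i - m) 1 _ mgt1 E2; lia.
have inorb z : inv_conn kap mu x z -> exists2 i, i < m & z = iter i p x.
  have cl : closed (inv_step kap mu) (fconnect p x).
    apply: intro_closed; first exact: inv_conn_sym.
    have back w i : iter i p w \in fconnect p x -> w \in fconnect p x.
      rewrite !inE => /connect_trans; apply.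
      by rewrite fconnect_sym // fconnect_iter.
    move=> u v /= /orP[]/eqP-> /iter_findex {1}<-.
    - by apply: (back _ (findex p x u)); rewrite pkap inE fconnect1.
    - by apply: (back _ (findex p x u)); rewrite pmu inE.
  move=> xz; have : z \in fconnect p x.
    by rewrite -(closed_connect cl xz) inE connect0.
  by move=> xpz; exists (findex p x z); rewrite ?findex_max ?iter_findex.
have conn i : inv_conn kap mu x (iter i p x).
  elim: i => [|i IH]; first exact: connect0.
  by rewrite iterS /p /= inv_conn_kap // inv_conn_mu.
(* Modulo [m], the exponents of fixed points solve 2i = 0 for [mu] and 2i = 1 for [kap]. If [m] is
   even, the other end is a second fixed point of [mu]; if [m] is odd, it is the only fixed point of
   [kap]. *)
have [[k km k0]|[k km]] :
    (exists2 k, m = k + k & 0 < k) \/ (exists k, m.+1 = k + k).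
  have E := odd_double_half m; rewrite -addnn in E.
  by case: (odd m) E => E; [right; exists m./2.+1|left; exists m./2]; lia.
- exists (iter k p x).
  have muy : mu (iter k p x) = iter k p x.
    apply: (itinj k); rewrite pmu -iterD -km; exact/esym.
  split=> //.
  + rewrite /one_fixed muy eqxx addbT; apply/eqP => /fixkap; lia.
  + by apply/eqP => /(itI k 0); lia.
  + move=> z /inorb[i im ->] /orP[/eqP/(fixkap _ im)|/eqP/(fixmu _ im)].
      lia.
    by case=> [->|E]; [left|right; congr (iter _ _ _); lia].
- exists (iter k p x).
  have kapy : kap (iter k p x) = iter k p x.
    apply: (itinj k); rewrite pkap -iterD -km iterS pm //.
  split=> //.
  + rewrite /one_fixed kapy eqxx /=; apply/eqP => /fixmu; lia.
  + by apply/eqP => /(itI k 0); lia.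
  + move=> z /inorb[i im ->] /orP[/eqP/(fixkap _ im)|/eqP/(fixmu _ im)].
      by move=> E; right; congr (iter _ _ _); lia.
    by case=> [->|E]; [left|lia].
Qed.

Lemma endpoint kap mu x : involutive kap -> involutive mu ->
  one_fixed kap mu x ->
  exists y, [/\ one_fixed kap mu y, y != x, inv_conn kap mu x y &
    forall z, inv_conn kap mu x z -> (kap z == z) || (mu z == z) ->
      z = x \/ z = y].
Proof.
move=> kapK muK; rewrite /one_fixed.
case: (eqVneq (mu x) x) => [mux|mux].
  by rewrite addbT => kapx; apply: endpoint_aux.
rewrite addbF => /eqP kapx.
have [y [y1 yx xy H]] := endpoint_aux muK kapK kapx mux.
have E : inv_conn mu kap =2 inv_conn kap mu.
  by apply: eq_connect => u v; rewrite /inv_step /= orbC.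
exists y; split=> //; first by move: y1; rewrite /one_fixed addbC.
  by rewrite -E.
by move=> z; rewrite -E orbC; apply: H.
Qed.

Definition chain_end kap mu (x : V) : V :=
  odflt x [pick y | [&& one_fixed kap mu y, y != x & inv_conn kap mu x y]].

Section ChainEnd.
Variables kap mu : V -> V.
Hypotheses (kapK : involutive kap) (muK : involutive mu).
Local Notation W := (one_fixed kap mu).
Local Notation tau := (chain_end kap mu).

Lemma chain_endP x : W x ->
  [/\ W (tau x), tau x != x, inv_conn kap mu x (tau x) &
    forall z, inv_conn kap mu x z -> (kap z == z) || (mu z == z) ->
      z = x \/ z = tau x].
Proof.
move=> Wx; have [y [Wy yx xy H]] := endpoint kapK muK Wx.
rewrite /chain_end; case: pickP => [t /and3P[Wt tx xt]|/(_ y)]; last first.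
  by rewrite Wy yx xy.
have Wfix z : W z -> (kap z == z) || (mu z == z).
  by rewrite /one_fixed; do 2 case: eqP.
split=> // z xz fz; have [E|->] := H z xz fz; first by left.
have [E|->] := H t xt (Wfix _ Wt); last by right.
by rewrite E eqxx in tx.
Qed.

Lemma one_fixed_fixed x : W x -> (kap x == x) || (mu x == x).
Proof. by rewrite /one_fixed; do 2 case: eqP. Qed.

Lemma chain_endK x : W x -> tau (tau x) = x.
Proof.
move=> Wx; have [Wt tx xt H] := chain_endP Wx.
have [Wtt ttx xtt _] := chain_endP Wt.
have xtt' : inv_conn kap mu x (tau (tau x)) by apply: connect_trans xt xtt.
have [//|E] := H _ xtt' (one_fixed_fixed Wtt).
by rewrite E eqxx in ttx.
Qed.

(** Kempe changes on many paths at once are prescribed by a predicate on path ends. Cycles and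
    isolated vertices are never included; once [F] agrees at the two ends of each path, it decides
    whether the path is taken. *)
Definition chain_union (F : pred V) : pred V :=
  [pred v | [exists x, [&& W x, F x & inv_conn kap mu x v]]].

Lemma chain_union_kap F v : chain_union F (kap v) = chain_union F v.
Proof. by apply: eq_existsb => x; rewrite inv_conn_kap. Qed.

Lemma chain_union_mu F v : chain_union F (mu v) = chain_union F v.
Proof. by apply: eq_existsb => x; rewrite inv_conn_mu. Qed.

Lemma chain_unionE (F : pred V) x : (forall y, W y -> F (tau y) = F y) ->
  W x -> chain_union F x = F x.
Proof.
move=> Ft Wx; apply/existsP/idP => [[y /and3P[Wy Fy yx]]|Fx].
  have [_ _ _ H] := chain_endP Wy.
  by have [->|->] := H _ yx (one_fixed_fixed Wx); rewrite ?Ft.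
by exists x; rewrite Wx Fx /inv_conn connect0.
Qed.

End ChainEnd.
End Endpoint.

(** The union of two perfect matchings is bipartite: each component splits into two orbits of
    [kap \o mu], exchanged by both involutions. The ranks of the orbit roots decide which of the two
    orbits gets which value. *)
Lemma fpf_involutions_bicoloring (T : finType) (kap mu : T -> T) :
  involutive kap -> involutive mu ->
  (forall x, kap x != x) -> (forall x, mu x != x) ->
  exists s : T -> bool, forall x, s (kap x) = ~~ s x /\ s (mu x) = ~~ s x.
Proof.
move=> kapK muK kapN muN; pose p := kap \o mu.
have pI : injective p by apply: inj_comp; apply: can_inj; eassumption.
have itinj n : injective (iter n p) by elim: n => [|n IH] u v //= /pI/IH.
have pkp x : p (kap (p x)) = kap x by rewrite /p /= kapK muK.
have kapiter i x : iter i p (kap (iter i p x)) = kap x.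
  by elim: i x => [|i IH] x //; rewrite iterSr [iter i.+1 p x]iterS pkp.
have symp : connect_sym (frel p) by apply: fconnect_sym.
(* An orbit of [p] meeting its image under [kap] would contain a fixed point
   of [kap] or of [mu], half-way between [x] and [kap x]. *)
have disj x : ~~ fconnect p x (kap x).
  apply/negP => /iter_findex; move: (findex _ _ _) => i Ei.
  have E := odd_double_half i; set j := i./2 in E.
  have kj : iter j p (kap (iter j p x)) = iter i p x by rewrite kapiter.
  case: (odd i) E => /= E; rewrite -{}E -addnn in kj.
    rewrite add1n -addSn addnC iterD in kj.
    have := itinj _ _ _ kj; rewrite iterS /p /= => /(can_inj kapK) /esym.
    by apply/eqP/muN.
  rewrite add0n iterD in kj; have := itinj _ _ _ kj.
  by apply/eqP/kapN.
have kroot x y : fconnect p x y -> fconnect p (kap x) (kap y).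
  move=> /iter_findex <-; rewrite -(kapiter (findex p x y) x) symp.
  exact: fconnect_iter.
pose r x := enum_rank (froot p x).
have rk x : r x != r (kap x).
  by rewrite (inj_eq enum_rank_inj) (root_connect symp); apply: disj.
have rE x y : fconnect p x y -> r x = r y.
  by move=> xy; congr enum_rank; apply/eqP; rewrite (root_connect symp).
have rmu x : r (mu x) = r (kap x).
  apply/esym/rE; have -> : mu x = kap (p x) by rewrite /p /= kapK.
  exact/kroot/fconnect1.
exists (fun x => r x < r (kap x)) => x.
have flip (i j : 'I_#|T|) : i != j -> (j < i) = ~~ (i < j).
  by rewrite -leqNgt [j < i]ltn_neqAle eq_sym => ->.
split; first by rewrite kapK -flip.
rewrite rmu -flip //; congr (_ < nat_of_ord _); apply/esym/rE.
by rewrite -/(p x) fconnect1.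
Qed.

(** Doubling removes the fixed points: in two copies of [T], each fixed point is matched with its
    twin, and the bicolouring is read off on one copy. *)
Lemma involutions_bicoloring (T : finType) (kap mu : T -> T) :
  involutive kap -> involutive mu ->
  exists s : T -> bool, forall x,
    (kap x != x -> s (kap x) = ~~ s x) /\ (mu x != x -> s (mu x) = ~~ s x).
Proof.
move=> kapK muK.
pose lift f (p : T * bool) := (f p.1, if f p.1 == p.1 then ~~ p.2 else p.2).
have liftK f : involutive f -> involutive (lift f).
  move=> fK [x b]; rewrite /lift /= fK [x == _]eq_sym.
  by case: (f x == x); rewrite ?negbK.
have liftN f p : lift f p != p.
  case: p => x b; rewrite /lift xpair_eqE /=; case: ifP => //= _.
  by case: b.
have [s H] := fpf_involutions_bicoloring (liftK _ kapK) (liftK _ muK)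
  (liftN kap) (liftN mu).
exists (fun x => s (x, false)) => x; have [H1 H2] := H (x, false).
by split=> /negPf N; [rewrite -H1|rewrite -H2]; rewrite /lift /= N.
Qed.

(** * Edge colourings and Vizing's theorem *)

Lemma mem_tperm_imset (T : finType) (a b c : T) (S : {set T}) :
  (c \in tperm a b @: S) = (tperm a b c \in S).
Proof. by rewrite -{1}[c](tpermK a b) mem_imset //; apply: perm_inj. Qed.

Lemma exists_subset_card (T : finType) (S : {set T}) n :
  n <= #|S| -> exists2 S' : {set T}, S' \subset S & #|S'| = n.
Proof.
move=> nS; exists [set x in take n (enum S)].
  by apply/subsetP => x; rewrite inE => /mem_take; rewrite mem_enum.
rewrite cardsE; have /card_uniqP -> := take_uniq n (enum_uniq (mem S)).
by rewrite size_takel // -cardE.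
Qed.

Section Coloring.
Variables V C : finType.
Implicit Types (e : rel V) (s : C -> V -> V) (v : V) (a b c : C).

(* A proper edge colouring is given by its colour classes, each being a
   matching presented as the involution whose fixed points are the vertices
   missing the colour. *)
Definition coloring e s : Prop :=
  [/\ forall a, involutive (s a),
      forall a v, s a v != v -> e v (s a v),
      forall u v, e u v -> exists a, s a u = v &
      forall a b v, s a v = s b v -> s a v != v -> a = b].

Definition pal s v : {set C} := [set a | s a v != v].

(** [Z] will be any set closed under both classes, not just one chain, so that several chains can be
    exchanged simultaneously. *)
Definition kswap s a b (Z : pred V) : C -> V -> V :=
  fun c v => if Z v then s (tperm a b c) v else s c v.

Lemma eq_coloring e e' s : e =2 e' -> coloring e s -> coloring e' s.
Proof.
by move=> E [sK sE eS sU]; split=> // [a v|u v]; rewrite -E; [apply: sE|apply: eS].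
Qed.

Lemma card_pal e s v : irreflexive e -> coloring e s ->
  #|pal s v| = #|[set u | e v u]|.
Proof.
move=> eI [sK sE eS sU]; rewrite -(@card_in_imset _ _ (fun a => s a v)).
  apply: eq_card => u; rewrite !inE; apply/imsetP/idP => [[a]|Hu].
    by rewrite inE => /sE ? ->.
  have [a E] := eS _ _ Hu.
  by exists a; rewrite // inE E; apply: contraTneq Hu => ->; rewrite eI.
by move=> a b; rewrite !inE => av _ E; apply: sU E av.
Qed.

Section Kswap.
Variables (e : rel V) (s : C -> V -> V) (a b : C) (Z : pred V).
Hypotheses (es : coloring e s).
Hypotheses (Za : forall v, Z (s a v) = Z v) (Zb : forall v, Z (s b v) = Z v).

Lemma kswap_other c : c != a -> c != b -> kswap s a b Z c =1 s c.
Proof. by move=> ca cb v; rewrite /kswap tpermD 1?eq_sym //; case: ifP. Qed.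

Lemma kswap_coloring : coloring e (kswap s a b Z).
Proof.
case: es => sK sE eS sU; split.
- move=> c v; have [ca|] := boolP (c == a).
    rewrite (eqP ca) /kswap tpermL; case: (boolP (Z v)) => Zv.
      by rewrite Zb Zv sK.
    by rewrite Za (negPf Zv) sK.
  have [cb|cb ca] := boolP (c == b).
    rewrite (eqP cb) /kswap tpermR => _; case: (boolP (Z v)) => Zv.
      by rewrite Za Zv sK.
    by rewrite Zb (negPf Zv) sK.
  by rewrite !kswap_other ?sK.
- by move=> c v; rewrite /kswap; case: ifP => _; apply: sE.
- move=> u v /eS[c <-]; exists (if Z u then tperm a b c else c).
  by rewrite /kswap; case: (Z u); rewrite ?tpermK.
- move=> c c' v; rewrite /kswap; case: ifP => _; last exact: sU.
  by move=> E N; apply: (@perm_inj _ (tperm a b)); apply: sU E N.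
Qed.

Lemma pal_kswap v :
  pal (kswap s a b Z) v = if Z v then tperm a b @: pal s v else pal s v.
Proof.
apply/setP => c; rewrite !inE /kswap; case: ifP => _; rewrite ?inE //.
by rewrite mem_tperm_imset inE.
Qed.

End Kswap.
End Coloring.

Lemma inv_conn_fixed (V : finType) (kap mu : V -> V) x z :
  involutive kap -> involutive mu ->
  kap x = x -> mu x = x -> inv_conn kap mu x z -> z = x.
Proof.
move=> kapK muK kx mx.
have cl : closed (inv_step kap mu) (pred1 x).
  apply: intro_closed; first exact: inv_conn_sym.
  by move=> u v /= /orP[]/eqP-> /eqP->; rewrite inE ?kx ?mx.
move=> xz; apply/eqP; have := closed_connect cl xz.
by rewrite !inE eqxx => <-.
Qed.

(** * Vizing's theorem, adding one vertex at a time *)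

Section Vizing.
Variables V C : finType.
Implicit Types (e : rel V) (s : C -> V -> V) (M : V -> {set C}).

Definition off_vertex e v : rel V := [rel x y | [&& e x y, x != v & y != v]].

Lemma off_vertex_isolated e v : symmetric e -> (forall w, e v w = false) ->
  off_vertex e v =2 e.
Proof.
move=> e_sym noN x y; rewrite /off_vertex /=; case E: (e x y) => //=.
apply/andP; split; apply/eqP => E'; move: E; rewrite E' ?noN //.
by rewrite e_sym noN.
Qed.

Definition uses_only (A : {set C}) s := forall a u, a \notin A -> s a u = u.

Section Extension.
Variables (e : rel V) (v z : V) (A : {set C}) (N : {set V}).

(** The graph without [v] is coloured, and each neighbour [u] of [v] offers a list [p.2 u] of
    colours missing at it. The exceptional [z] with a single colour makes the total length of the
    lists odd, which forces a colour to be offered exactly once. *)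
Definition selection (p : (C -> V -> V) * (V -> {set C})) : Prop :=
  [/\ coloring (off_vertex e v) p.1, uses_only A p.1 &
      forall u, u \in N -> p.2 u \subset A :\: pal p.1 u /\
                           #|p.2 u| = if u == z then 1 else 2].

Definition selecting M (i : C) : {set V} := [set u in N | i \in M u].

Definition selection_weight (p : (C -> V -> V) * (V -> {set C})) : nat :=
  \sum_(i in A) #|selecting p.2 i| ^ 2.

Lemma selection_kswap s M i j (Z : pred V) : selection (s, M) ->
  i \in A -> j \in A ->
  (forall u, Z (s i u) = Z u) -> (forall u, Z (s j u) = Z u) ->
  selection (kswap s i j Z, fun u => if Z u then tperm i j @: M u else M u).
Proof.
case=> /= es sA sM iA jA Zi Zj.
have tA c : (tperm i j c \in A) = (c \in A) by case: tpermP => // ->; rewrite ?iA ?jA.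
split=> /=; first exact: kswap_coloring.
  move=> c u cA; rewrite /kswap; case: ifP => _; apply: sA => //.
  by rewrite tA.
move=> u uN; have [Mu cMu] := sM u uN; rewrite pal_kswap; case: ifP => _ //.
split; last by rewrite card_imset //; apply: perm_inj.
apply/subsetP => c; rewrite mem_tperm_imset => /(subsetP Mu).
by rewrite !inE tA mem_tperm_imset inE.
Qed.

(** Exchanging [i] and [j] on one component, lists included, moves q = 1 or 2 vertices from [i] to
    [j]; with a gap of at least 3 > q the sum of squares drops by 2q(gap - q) > 0. *)
Lemma selection_balance s M i j : selection (s, M) ->
  i \in A -> j \in A -> #|selecting M j| + 3 <= #|selecting M i| ->
  exists2 p, selection p & selection_weight p < selection_weight (s, M).
Proof.
move=> sel iA jA ji; have [/= es sA sM] := sel; have [sK _ _ _] := es.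
have ij : i != j by apply: contraTneq ji => ->; lia.
have miss c u : u \in selecting M c -> s c u = u.
  rewrite inE => /andP[uN cM]; have [/subsetP/(_ c cM) + _] := sM u uN.
  by rewrite !inE negbK => /andP[/eqP].
pose tau := chain_end (s i) (s j); pose W := one_fixed (s i) (s j).
have tauP x := @chain_endP _ _ _ (sK i) (sK j) x.
have tauK x := @chain_endK _ _ _ (sK i) (sK j) x.
(* A component that offers [i] but not [j] is needed. Otherwise [tau] would inject the vertices
   offering only [i] into those offering only [j], against the gap. *)
have [x xi [xj xt]] : exists2 x, x \in selecting M i & x \notin selecting M j
    /\ (W x -> tau x \notin selecting M j).
  apply: contrapT => no.
  have H x : x \in selecting M i :\: selecting M j ->
      W x /\ tau x \in selecting M j.
    rewrite inE => /andP[xj xi]; split; apply: contrapT => N'; apply: no;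
      exists x => //; split=> // Wx; apply/negP => //.
  suff: #|selecting M i :\: selecting M j| <= #|selecting M j :\: selecting M i|.
    by have := cardsID (selecting M j) (selecting M i);
       have := cardsID (selecting M i) (selecting M j); rewrite setIC; lia.
  rewrite -(@card_in_imset _ _ tau).
    apply: subset_leq_card; apply/subsetP => _ /imsetP[x /H[Wx tx] ->].
    rewrite inE tx andbT; apply/negP => /miss ti.
    by have [] := tauP x Wx; rewrite /one_fixed ti (miss j) ?eqxx.
  by move=> x y /H[Wx _] /H[Wy _] /(congr1 tau); rewrite /tau !tauK.
pose Z := inv_conn (s i) (s j) x.
have Zi u : Z (s i u) = Z u by apply: inv_conn_kap.
have Zj u : Z (s j u) = Z u by apply: inv_conn_mu.
have [t Zt tj] : exists2 t, (forall u c, c \in [set i; j] -> Z u ->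
    u \in selecting M c -> u \in [set x; t]) & t \notin selecting M j.
  have [Wx|Wx] := boolP (W x).
    exists (tau x); last exact: xt.
    move=> u c /set2P cij Zu /miss su; have [_ _ _ H] := tauP x Wx.
    have fu : (s i u == u) || (s j u == u).
      by case: cij su => -> ->; rewrite eqxx ?orbT.
    by have [->|->] := H u Zu fu; rewrite ?set21 ?set22.
  exists x => // u c _ Zu _; have si := miss i x xi.
  have sj : s j x = x.
    by move: Wx; rewrite /W /one_fixed si eqxx /= negbK => /eqP.
  by rewrite (inv_conn_fixed (sK i) (sK j) si sj Zu) set21.
set M' := fun u => if Z u then tperm i j @: M u else M u.
exists (kswap s i j Z, M'); first exact: selection_kswap.
have cardM' c : #|selecting M' c| = #|[set u in selecting M (tperm i j c) | Z u]|
    + #|[set u in selecting M c | ~~ Z u]|.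
  rewrite -(cardsID [set u | Z u]); congr (_ + _); apply: eq_card => u;
    rewrite !inE /M'; case: (Z u);
    by rewrite ?mem_tperm_imset ?andbT ?andbF.
have cardM c : #|selecting M c| = #|[set u in selecting M c | Z u]|
    + #|[set u in selecting M c | ~~ Z u]|.
  rewrite -(cardsID [set u | Z u]); congr (_ + _); apply: eq_card => u.
    by rewrite !inE.
  by rewrite !inE andbC.
have Zj0 : #|[set u in selecting M j | Z u]| = 0.
  apply/eqP; rewrite cards_eq0; apply/eqP/setP => u; rewrite [RHS]inE.
  apply/negbTE/negP; rewrite inE => /andP[uj Zu].
  have := Zt u j (set22 _ _) Zu uj => /set2P[]E; rewrite E in uj.
    by rewrite uj in xj.
  by rewrite uj in tj.
have Zi12 : 0 < #|[set u in selecting M i | Z u]| <= 2.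
  apply/andP; split; first by apply/card_gt0P; exists x; rewrite inE xi /Z /inv_conn connect0.
  apply: leq_trans (_ : #|[set x; t]| <= 2); last by rewrite cards2; case: (_ != _).
  apply: subset_leq_card; apply/subsetP => u; rewrite inE => /andP[ui Zu].
  exact: Zt (set21 _ _) Zu ui.
have split2 (F : C -> nat) : \sum_(c in A) F c =
    F i + F j + \sum_(c in A | (c != i) && (c != j)) F c.
  have jAi : (j \in A) && (j != i) by rewrite jA eq_sym.
  rewrite (bigD1 i iA) /= (bigD1 j jAi) /= addnA; congr (_ + _).
  by apply: eq_bigl => c; rewrite andbA.
rewrite /selection_weight /= !split2.
rewrite (eq_bigr (fun c => #|selecting M c| ^ 2)); last first.
  move=> c /and3P[_ ci cj]; congr (_ ^ 2); rewrite cardM' cardM.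
  by rewrite tpermD // eq_sym.
rewrite ltn_add2r !cardM' tpermL tpermR.
move: ji Zi12; rewrite (cardM i) (cardM j) Zj0.
move: #|_| #|_| #|_| => p q r H /andP[p0 p2].
have [E|E] : q = 1 \/ q = 2 by lia.
  by rewrite E in H *; rewrite -!mulnn; lia.
by rewrite E in H *; rewrite -!mulnn; lia.
Qed.

(** The lists have total length 2|N| - 1, which is odd and less than 2|A|. If no colour were offered
    exactly once, some colour would be offered by nobody and another an odd number of times, hence
    at least 3 times, against minimality of the weight. *)
Lemma exists_selecting1 s M : z \in N -> #|N| <= #|A| -> selection (s, M) ->
  exists s' M' i, [/\ selection (s', M'), i \in A & #|selecting M' i| = 1].
Proof.
move=> zN NA sel.
have [[s' M'] [sel' min]] := @exists_minimizer _ selection selection_weight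
  (ex_intro _ _ sel).
exists s', M'; have [/= _ _ sM] := sel'.
have total : \sum_(i in A) #|selecting M' i| = (#|N|.-1).*2.+1.
  transitivity (\sum_(u in N) #|M' u|).
    rewrite (eq_bigr (fun i => \sum_(u in N) (i \in M' u))); last first.
      move=> i _; rewrite -sum1_card big_mkcond [RHS]big_mkcond /=.
      by apply: eq_bigr => u _; rewrite inE; case: (u \in N) => //=; case: (_ \in _).
    rewrite exchange_big /=; apply: eq_bigr => u uN.
    rewrite -sum1_card big_mkcond [RHS]big_mkcond /=; apply: eq_bigr => i _.
    have [/subsetP MA _] := sM u uN; case: (boolP (i \in M' u)) => [/MA|].
      by rewrite inE => /andP[_ ->].
    by case: ifP.
  rewrite (bigD1 z) //= (eq_bigr (fun=> 2)); last first.
    by move=> u /andP[uN uz]; have [_ ->] := sM u uN; rewrite (negPf uz).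
  have [_ ->] := sM z zN; rewrite eqxx sum_nat_const.
  have -> : #|[pred u | (u \in N) && (u != z)]| = #|N|.-1.
    rewrite (cardsD1 z N) zN /=; apply: eq_card => u.
    by rewrite !inE andbC.
  by rewrite add1n muln2.
apply: contrapT => no.
have ne1 i : i \in A -> #|selecting M' i| != 1.
  by move=> iA; apply/eqP => E; apply: no; exists i.
have [j jA j0] : exists2 j, j \in A & #|selecting M' j| = 0.
  apply: contrapT => no0.
  have : \sum_(i in A) 2 <= \sum_(i in A) #|selecting M' i|.
    apply: leq_sum => i iA; have := ne1 i iA.
    case E: #|selecting M' i| => [|[|n]] // _.
    by case: no0; exists i.
  rewrite total sum_nat_const; have : 0 < #|N| by apply/card_gt0P; exists z.
  lia.
have [i iA i3] : exists2 i, i \in A & 3 <= #|selecting M' i|.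
  apply: contrapT => no3.
  suff : ~~ odd (\sum_(i in A) #|selecting M' i|) by rewrite total /= odd_double.
  elim/big_ind: _ => // [x y|i iA]; first by rewrite oddD => /negPf -> /negPf ->.
  have := ne1 i iA; case E: #|selecting M' i| => [|[|[|n]]] // _.
  by case: no3; exists i; rewrite ?E.
have ji : #|selecting M' j| + 3 <= #|selecting M' i| by rewrite j0.
have [p selp] := selection_balance sel' iA jA ji.
by rewrite ltnNge min.
Qed.

End Extension.

(** Induction on the number of colours. If only the neighbour [u] offers [i], the class [i] together
    with the edge uv is set aside as a matching. The lists of the other neighbours avoid [i], so
    they remain valid for [A :\ i] and the remaining graph. *)
Lemma vizing_extension (A : {set C}) e s M v z :
  symmetric e -> irreflexive e ->
  coloring (off_vertex e v) s -> uses_only A s ->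
  #|[set u | e v u]| <= #|A| ->
  (forall u, e v u ->
    M u \subset A :\: pal s u /\ (if u == z then 1 else 2) <= #|M u|) ->
  exists2 r, coloring e r & uses_only A r.
Proof.
move: {2}#|A| (erefl #|A|) => n.
elim: n A e s M z => [|n IH] A e s M z An e_sym e_irr es sA NA sM.
  exists s => //; apply: eq_coloring es; apply: off_vertex_isolated => // w.
  move: NA; rewrite An leqn0 cards_eq0 => /eqP/setP/(_ w).
  by rewrite !inE.
set N := [set u | e v u].
have N_nbr u : (u \in N) = e v u by rewrite inE.
have [N0|[z0 z0N]] : N = set0 \/ exists u, u \in N.
  by case: (set_0Vmem N) => [|[u]]; [left|right; exists u].
  exists s => //; apply: eq_coloring es; apply: off_vertex_isolated => // w.
  by rewrite -N_nbr N0 inE.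
(* When the exceptional vertex is no longer a neighbour, another one takes its role by shortening
   its list: the parity argument needs one list of length 1. *)
pose z1 := if z \in N then z else z0.
have z1N : z1 \in N by rewrite /z1; case: ifP.
have ex u : exists S : {set C}, u \in N ->
    S \subset M u /\ #|S| = if u == z1 then 1 else 2.
  have [uN|uN] := boolP (u \in N); last by exists set0.
  have [_ H] := sM u (etrans (esym (N_nbr u)) uN).
  have : (if u == z1 then 1 else 2) <= #|M u|.
    apply: leq_trans H; rewrite /z1; case: (boolP (z \in N)) => // zN.
    have /negPf -> : u != z by apply: contraNneq zN => <-.
    by case: ifP.
  by case/exists_subset_card => S SM cS; exists S.
have [M1 M1P] := choice ex.
have sel : selection e v z1 A N (s, M1).
  split=> // u uN; have [S1 S2] := M1P u uN; split=> //.
  by have [S3 _] := sM u (etrans (esym (N_nbr u)) uN); apply: subset_trans S1 S3.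
have [s2 [M2 [i [[/= es2 s2A sM2] iA /eqP/cards1P[u Yu]]]]] :=
  exists_selecting1 z1N NA sel.
have [s2K s2E e2S s2U] := es2.
have : u \in selecting N M2 i by rewrite Yu set11.
rewrite inE N_nbr => /andP[vu iMu].
have uv : e u v by rewrite e_sym.
have unv : u != v by apply: contraTneq vu => ->; rewrite e_irr.
have siu : s2 i u = u.
  have [/subsetP/(_ i iMu)] := sM2 u (etrans (N_nbr u) vu).
  by rewrite !inE negbK => /andP[/eqP].
have sv c : s2 c v = v.
  by apply/eqP/negPn/negP => /s2E; rewrite /off_vertex /= eqxx andbF.
pose e' : rel V := [rel x y | [&& e x y, s2 i x != y, (x, y) != (u, v) & (x, y) != (v, u)]].
have e'_sym : symmetric e'.
  move=> x y; rewrite /e' /= e_sym (inv_eq (s2K i)) [x == _]eq_sym.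
  by congr [&& _, _ & _]; rewrite !xpair_eqE andbC; congr (_ && _); rewrite andbC.
have e'_irr : irreflexive e' by move=> x; rewrite /e' /= e_irr.
pose s3 c := if c == i then id else s2 c.
have es3 : coloring (off_vertex e' v) s3.
  split.
  - by move=> c x; rewrite /s3; case: ifP => _ //; apply: s2K.
  - move=> c x; rewrite /s3; case: (eqVneq c i) => [|ci]; first by rewrite eqxx.
    move=> N'; have := s2E c x N'; rewrite /off_vertex /= => /and3P[E xv sxv].
    rewrite xv sxv /e' /= E !xpair_eqE (negPf xv) (negPf sxv) andbF /= !andbT.
    by apply: contra_neq ci => E'; apply: (s2U _ _ x).
  - move=> x y; rewrite /off_vertex /e' /= => /and3P[/and4P[exy si _ _] xv yv].
    have [|c cE] := e2S x y; first by rewrite /off_vertex /= exy xv yv.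
    exists c; rewrite /s3; case: eqP => // ci.
    by rewrite -ci cE eqxx in si.
  - move=> c c' x; rewrite /s3; case: (eqVneq c i) => [|ci]; first by rewrite eqxx.
    case: (eqVneq c' i) => [_ -> |_]; first by rewrite eqxx.
    exact: s2U.
have s3A : uses_only (A :\ i) s3.
  move=> c x; rewrite !inE negb_and negbK /s3; case: eqP => //= _.
  exact: s2A.
have NE : [set w | e' v w] = N :\ u.
  apply/setP => w; rewrite !inE /e' /= sv !xpair_eqE eqxx /= (eq_sym v u) (negPf unv) /=.
  case E: (e v w); rewrite ?andbF //= !andbT.
  by rewrite -[v == w]negbK (_ : v != w) //; apply: contraTneq E => <-; rewrite e_irr.
have NA' : #|[set w | e' v w]| <= #|A :\ i|.
  by move: NA; rewrite NE (cardsD1 u N) N_nbr vu (cardsD1 i A) iA.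
have sM' w : e' v w -> M2 w \subset A :\ i :\: pal s3 w /\
    (if w == z1 then 1 else 2) <= #|M2 w|.
  move=> vw; have : w \in N :\ u by rewrite -NE inE.
  rewrite !inE => /andP[wu wN]; have [/subsetP S1 ->] := sM2 w (etrans (N_nbr w) wN).
  split=> //; apply/subsetP => c cM; have := S1 c cM; rewrite !inE /s3 !negbK.
  case: (eqVneq c i) cM => [-> cM|_ _]; last by rewrite andTb.
  have : w \in selecting N M2 i by rewrite inE N_nbr wN.
  by rewrite Yu inE (negPf wu).
have cA' : #|A :\ i| = n by move: An; rewrite (cardsD1 i) iA => -[].
have [r [rK rE er rU] rA] := IH _ _ _ _ _ cA' e'_sym e'_irr es3 s3A NA' sM'.
have ri x : r i x = x by apply: rA; rewrite !inE eqxx.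
(* Both [u] and [v] are fixed by [s2 i], so composing with their transposition adds the edge uv to
   the matching [i]. *)
pose f c := if c == i then (fun x => tperm u v (s2 i x)) else r c.
have fi x : f i x = tperm u v (s2 i x) by rewrite /f eqxx.
have fr c : c != i -> f c = r c by rewrite /f => /negPf ->.
have s2D x : x != u -> x != v -> tperm u v (s2 i x) = s2 i x.
  move=> xu xv; apply: tpermD.
    by rewrite -siu (inj_eq (can_inj (s2K i))) eq_sym.
  by rewrite -(sv i) (inj_eq (can_inj (s2K i))) eq_sym.
have fiP x : [\/ x = u /\ f i x = v, x = v /\ f i x = u |
    [/\ x != u, x != v & f i x = s2 i x]].
  rewrite fi; case: (eqVneq x u) => [->|xu]; first by rewrite siu tpermL; constructor 1.
  case: (eqVneq x v) => [->|xv]; first by rewrite sv tpermR; constructor 2.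
  by constructor 3; rewrite s2D.
have notboth x c : c != i -> r c x != x -> f i x != r c x.
  move=> ci /rE; rewrite /e' /= => /and4P[_ H1 H2 H3]; apply/eqP => E.
  move: H1 H2 H3; rewrite -E.
  by case: (fiP x) => [[-> ->]|[-> ->]|[_ _ ->]]; rewrite ?eqxx.
exists f; last first.
  move=> c x cA; have ci : c != i by apply: contraNneq cA => ->.
  by rewrite fr // rA // !inE negb_and cA orbT.
split.
- move=> c x; have [->|ci] := eqVneq c i; last by rewrite fr //; apply: rK.
  case: (fiP x) => [[-> ->]|[-> ->]|[xu xv ->]]; rewrite fi.
  + by rewrite sv tpermR.
  + by rewrite siu tpermL.
  + by rewrite s2K tpermD // eq_sym.
- move=> c x; have [->|ci] := eqVneq c i; last first.
    by rewrite fr // => /rE; rewrite /e' /= => /andP[].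
  case: (fiP x) => [[-> ->]|[-> ->]|[_ _ ->]] // /s2E.
  by rewrite /off_vertex /= => /andP[].
- move=> x y exy.
  case: (eqVneq (f i x) y) => [E|fxy]; first by exists i.
  have : e' x y.
    rewrite /e' /= exy /= !xpair_eqE; move: fxy.
    have xy : x != y by apply: contraTneq exy => ->; rewrite e_irr.
    case: (fiP x) => [[xE ->]|[xE ->]|[xu xv ->]].
    + by rewrite xE in xy *; rewrite siu xy eqxx (negPf unv) /= andbT eq_sym.
    + by rewrite xE in xy *; rewrite sv xy eqxx (eq_sym v u) (negPf unv) /= eq_sym.
    + by move=> ->; rewrite (negPf xu) (negPf xv).
  case/er => c cE; exists c; rewrite fr //; apply: contraTneq exy => ci.
  by rewrite -cE ci ri e_irr.
- move=> c c' x; case: (eqVneq c i) => [->|ci]; case: (eqVneq c' i) => [->|c'i] //.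
  + rewrite (fr c') // => E N'; have := notboth x c' c'i; rewrite -E => /(_ N').
    by rewrite eqxx.
  + rewrite (fr c) // => E N'; have := notboth x c ci N'.
    by rewrite E eqxx.
  + by rewrite !fr //; apply: rU.
Qed.

End Vizing.

Theorem vizing (V C : finType) (e : rel V) :
  symmetric e -> irreflexive e -> (forall v, #|[set u | e v u]| < #|C|) ->
  exists s : C -> V -> V, coloring e s.
Proof.
move=> e_sym e_irr deg.
have main (B : {set V}) : exists s : C -> V -> V,
    coloring [rel x y | [&& e x y, x \in B & y \in B]] s.
  move: {2}#|B| (erefl #|B|) => n; elim: n B => [|n IH] B cB.
    have B0 : B = set0 by apply/eqP; rewrite -cards_eq0 cB.
    exists (fun _ => id); split=> //= [a v|u v|a b v]; rewrite ?eqxx //.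
    by rewrite B0 !inE /= andbF.
  have /card_gt0P[v vB] : 0 < #|B| by rewrite cB.
  have [|s es] := IH (B :\ v); first by move: cB; rewrite (cardsD1 v) vB => -[].
  pose eB : rel V := [rel x y | [&& e x y, x \in B & y \in B]].
  have eB_sym : symmetric eB by move=> x y; rewrite /eB /= e_sym [(x \in B) && _]andbC.
  have eB_irr : irreflexive eB by move=> x; rewrite /eB /= e_irr.
  have eBs : coloring (off_vertex eB v) s.
    apply: eq_coloring es => x y; rewrite /off_vertex /eB /= !inE.
    by do !case: (_ \in _); do !case: (_ != _); rewrite ?andbT ?andbF.
  have sT : uses_only [set: C] s by move=> a u; rewrite inE.
  have Nle : #|[set u | eB v u]| <= #|[set: C]|.
    rewrite cardsT; apply: leq_trans (ltnW (deg v)); apply: subset_leq_card.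
    by apply/subsetP => u; rewrite !inE => /andP[].
  (* Without [v], each of its neighbours has degree at most |C| - 2 and so misses two colours. No
     exceptional neighbour is needed, and [z := v] designates none. *)
  have [u vu|r] := vizing_extension (M := fun u => ~: pal s u) (z := v)
    eB_sym eB_irr eBs sT Nle; last by exists r.
  split; first by rewrite setTD.
  apply: leq_trans (_ : 2 <= _); first by case: ifP.
  have irr' : irreflexive (off_vertex eB v) by move=> x; rewrite /off_vertex /= eB_irr.
  have := cardsC (pal s u); rewrite (card_pal u irr' eBs).
  have {}vu : e v u by move/andP: vu => [].
  have : #|[set w | off_vertex eB v u w]| < #|[set w | e u w]|.
    apply: proper_card; apply/properP; split.
      by apply/subsetP => w; rewrite !inE /off_vertex /= => /andP[/andP[]].
    by exists v; rewrite !inE ?(e_sym u) // /off_vertex /= eqxx !andbF.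
  by have := deg u; lia.
have [s es] := main setT; exists s; apply: eq_coloring es => x y /=.
by rewrite !inE !andbT.
Qed.

(** * Balanced colourings *)

(* [lia] after clearing all hypotheses other than (in)equalities in [nat];
   the boolean hypotheses slow it down considerably. *)
Ltac nat_lia :=
  repeat match goal with
  | H : ?P |- _ => lazymatch P with
    | is_true (_ <= _) => fail
    | is_true ((_ <= _) && (_ <= _)) => fail
    | @eq nat _ _ => fail
    | _ => clear H
    end
  end; lia.

Section TpermImset.
Variables (T : finType) (a b : T).
Implicit Types P Q : {set T}.
Local Notation t := (tperm a b).

Lemma tperm_imsetK : involutive (fun P : {set T} => t @: P).
Proof. by move=> P; apply/setP => c; rewrite !mem_tperm_imset tpermK. Qed.

Lemma card_tperm_imset P : #|t @: P| = #|P|.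
Proof. by rewrite card_imset //; apply: perm_inj. Qed.

Lemma tperm_imset_eq P : (t @: P == P) = ((a \in P) == (b \in P)).
Proof.
apply/eqP/eqP => [E|E]; first by rewrite -{1}E mem_tperm_imset tpermL.
by apply/setP => c; rewrite mem_tperm_imset; case: tpermP => // ->.
Qed.

Lemma tperm_setDl P Q : a \in P -> b \notin P -> b \in Q -> a \notin Q ->
  #|P :\: Q| = #|t @: P :\: Q|.+1.
Proof.
move=> aP bP bQ aQ; rewrite (cardsD1 a) inE aQ aP; congr _.+1.
apply: eq_card => c; rewrite !inE mem_tperm_imset; case: tpermP => [->|->|/eqP ca _].
- by rewrite eqxx (negPf bP) andbF.
- by rewrite bQ andbF.
- by rewrite ca.
Qed.

Lemma tperm_setDr P Q : a \in P -> b \notin P -> b \in Q -> a \notin Q ->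
  #|P :\: Q| = #|P :\: t @: Q|.+1.
Proof.
move=> aP bP bQ aQ; rewrite (cardsD1 a) inE aQ aP; congr _.+1.
apply: eq_card => c; rewrite !inE mem_tperm_imset; case: tpermP => [->|->|/eqP ca _].
- by rewrite eqxx bQ.
- by rewrite (negPf bP) !andbF.
- by rewrite ca.
Qed.

End TpermImset.

Lemma card_between (T : finType) (S Q A : {set T}) :
  S :&: Q \subset A -> A \subset S :|: Q ->
  #|A :\: Q| + #|S :\: A| = #|S :\: Q|.
Proof.
move=> /subsetP lo /subsetP hi; rewrite -(cardsID A (S :\: Q)).
congr (_ + _); apply: eq_card => c; have := lo c; have := hi c; rewrite !inE;
  do 3 case: (_ \in _) => //=; by [move=> /(_ isT)|move=> _ /(_ isT)].
Qed.

Lemma sum_split_seq (T : finType) (l : seq T) (f : T -> nat) : uniq l ->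
  \sum_U f U = \sum_(U <- l) f U + \sum_(U | U \notin l) f U.
Proof.
by move=> ul; rewrite (bigID (fun U => U \in l)) /= -big_uniq.
Qed.

Section Balance.
Variables V C : finType.
Variable e : rel V.
Implicit Types (s : C -> V -> V) (S T U Y A B : {set C}).

Definition with_pal s U : {set V} := [set v | pal s v == U].
Definition cnt s U : nat := #|with_pal s U|.

Section Swap.
Variables (s : C -> V -> V) (a b : C).
Hypothesis es : coloring e s.
Local Notation t := (fun U : {set C} => tperm a b @: U).
Local Notation F := (with_pal s).
Local Notation W := (one_fixed (s a) (s b)).
Local Notation tau := (chain_end (s a) (s b)).

(* Pairs off the vertices with palette [U] with those of palette [t U], as
   long as both last. *)
Definition pal_pairing (v : V) : V :=
  nth v (enum (F (t (pal s v)))) (index v (enum (F (pal s v)))).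

Lemma mem_with_pal v : v \in enum (F (pal s v)).
Proof. by rewrite mem_enum inE. Qed.

Lemma pal_pairingP v (i := index v (enum (F (pal s v)))) :
  (i < #|F (t (pal s v))| /\ pal s (pal_pairing v) = t (pal s v) /\
   index (pal_pairing v) (enum (F (t (pal s v)))) = i) \/
  (#|F (t (pal s v))| <= i /\ pal_pairing v = v).
Proof.
rewrite /pal_pairing -/i; have [lt|ge] := ltnP i #|F (t (pal s v))|; last first.
  by right; rewrite nth_default // -cardE.
left; split=> //; rewrite cardE in lt; split; last by rewrite index_uniq ?enum_uniq.
by have := mem_nth v lt; rewrite mem_enum inE => /eqP.
Qed.

Lemma pal_pairingK : involutive pal_pairing.
Proof.
move=> v; case: (pal_pairingP v) => [[lt [pE iE]]|[_ E]]; last by rewrite !E.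
by rewrite {1}/pal_pairing pE tperm_imsetK iE nth_index ?mem_with_pal.
Qed.

Lemma one_fixedE v : W v = (t (pal s v) != pal s v).
Proof.
by rewrite /one_fixed tperm_imset_eq !inE; case: (_ == _); case: (_ == _).
Qed.

Lemma pal_pairing_one_fixed v : W (pal_pairing v) = W v.
Proof.
rewrite !one_fixedE; case: (pal_pairingP v) => [[_ [-> _]]|[_ ->]] //.
by rewrite tperm_imsetK eq_sym.
Qed.

Lemma pal_pairing_fixed v : W v -> pal_pairing v = v ->
  #|F (t (pal s v))| <= index v (enum (F (pal s v))).
Proof.
rewrite one_fixedE => Wv E; case: (pal_pairingP v) => [[_ [pE _]]|[]] //.
by rewrite -{2}E pE eqxx in Wv.
Qed.

(** In the graph formed by the pairing and by joining the two ends of each a/b-chain, an unpaired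
    vertex [x] of palette [S] begins a path, whose other end [y], of palette [Y], is unpaired too.
    Exchanging [a] and [b] on all chains along this path makes paired vertices trade palettes, so
    only [x] and [y] change the multiplicities. *)
Lemma cnt_swap S : cnt s (t S) < cnt s S ->
  exists s' Y, [/\ coloring e s', cnt s (t Y) < cnt s Y,
    Y = S -> cnt s (t S) + 2 <= cnt s S &
    forall U, cnt s' U + (U == S) + (U == Y) =
              cnt s U + (U == t S) + (U == t Y)].
Proof.
move=> ltS; have [sK _ _ _] := es; have sizeS : cnt s S = size (enum (F S)) by rewrite -cardE.
pose mu := pal_pairing; have muK : involutive mu := pal_pairingK.
have /card_gt0P[x0 _] : 0 < #|F S| by apply: leq_ltn_trans ltS.
(* The first vertex of palette [S] for which no partner of palette [t S] is left. *)
pose x := nth x0 (enum (F S)) (cnt s (t S)).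
have xS : x \in enum (F S) by apply: mem_nth; rewrite -sizeS.
have px : pal s x = S by move: xS; rewrite mem_enum inE => /eqP.
have ix : index x (enum (F S)) = cnt s (t S).
  by rewrite index_uniq ?enum_uniq // -sizeS.
have mux : mu x = x.
  by case: (pal_pairingP x) => [[]|[]] //; rewrite px ix ltnn.
have StS : t S != S by apply: contraTneq ltS => ->; rewrite ltnn.
have Wx : W x by rewrite one_fixedE px.
pose tau' v := if W v then tau v else v.
have tauP v := @chain_endP _ _ _ (sK a) (sK b) v.
have tauW v : W (tau' v) = W v.
  rewrite /tau'; case: (boolP (W v)) => Wv; last exact/negbTE.
  by have [-> _ _ _] := tauP v Wv.
have tau'K : involutive tau'.
  by move=> v; rewrite {1}/tau' tauW; case: ifP => Wv; rewrite /tau' Wv ?chain_endK.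
have tau'N v : W v -> tau' v != v.
  by move=> Wv; rewrite /tau' Wv; have [] := tauP v Wv.
have ofx : one_fixed tau' mu x by rewrite /one_fixed mux eqxx addbT tau'N.
have [y [ofy yx xy Zfix]] := endpoint tau'K muK ofx.
pose Z0 := inv_conn tau' mu x.
have ZW v : Z0 v -> W v.
  have cl : closed (inv_step tau' mu) W.
    apply: intro_closed; first exact: inv_conn_sym.
    move=> u w /= /orP[]/eqP-> Wu; first exact: etrans (tauW u) Wu.
    exact: etrans (pal_pairing_one_fixed u) Wu.
  by move=> xv; apply: etrans (esym (closed_connect cl xv)) Wx.
have Wy : W y by apply: ZW.
have muy : mu y = y.
  by apply/eqP; move: ofy; rewrite /one_fixed (negPf (tau'N y Wy)).
have Z0tau v : W v -> Z0 (tau v) = Z0 v.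
  move=> Wv; have tE : tau' v = tau v by rewrite /tau' Wv.
  by rewrite /Z0 -tE inv_conn_kap.
pose Z := chain_union (s a) (s b) Z0.
have ZE v : W v -> Z v = Z0 v by apply: chain_unionE.
pose s' := kswap s a b Z.
have palE v : pal s' v = if Z0 v then t (pal s v) else pal s v.
  rewrite pal_kswap; have [Wv|Wv] := boolP (W v); first by rewrite ZE.
  by move: Wv; rewrite one_fixedE negbK => /eqP ->; do 2 case: ifP.
have pyt : t (pal s y) != pal s y by rewrite -one_fixedE.
have iy := pal_pairing_fixed Wy muy.
have iyl : index y (enum (F (pal s y))) < cnt s (pal s y).
  by rewrite /cnt cardE index_mem mem_with_pal.
exists s', (pal s y); split.
- apply: kswap_coloring => // v; [exact: chain_union_kap|exact: chain_union_mu].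
- exact: leq_ltn_trans iyl.
- move=> pyS; rewrite pyS in iy iyl.
  have : index y (enum (F S)) != index x (enum (F S)).
    apply: contra_neq yx => E.
    by rewrite -(nth_index x0 xS) -E nth_index // mem_enum inE pyS.
  rewrite ix => ne; have lt : cnt s (t S) < index y (enum (F S)).
    by rewrite ltn_neqAle eq_sym ne.
  by rewrite addn2; apply: leq_ltn_trans lt iyl.
- move=> U.
  (* Within [Z0], [mu] matches palette [U'] with palette [t U'], apart from its fixed points [x] and
     [y]; the contributions [m U'] and [m (t U')] therefore cancel. *)
  pose g U' := #|[set v in F U' | Z0 v]|.
  pose m U' := [set v in F U' | Z0 v && (mu v != v)].
  have gE U' : g U' = #|m U'| + (U' == S) + (U' == pal s y).
    rewrite /g -(cardsID [set v | mu v != v]) -addnA; congr (_ + _).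
      by apply: eq_card => v; rewrite !inE -andbA.
    rewrite [LHS](_ : _ = #|[set v in [set x; y] | pal s v == U']|); last first.
      apply: eq_card => v; rewrite !inE negbK.
      apply/idP/idP => [/and3P[muv -> Zv]|/andP[/orP[]/eqP-> ->]].
      - have fv : (tau' v == v) || (mu v == v) by rewrite muv orbT.
        by have [->|->] := Zfix v Zv fv; rewrite eqxx ?orbT.
      - by rewrite mux eqxx /Z0 /inv_conn connect0.
      - by rewrite muy eqxx.
    rewrite -sum1_card big_mkcond /= (bigD1 x) //= (bigD1 y) //= big1.
      by rewrite !inE !eqxx orbT /= px !(eq_sym U') addn0; do 2 case: (_ == U').
    by move=> v /andP[vx vy]; rewrite !inE (negPf vx) (negPf vy).
  have mle U' : #|m U'| <= #|m (t U')|.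
    rewrite -(@card_imset _ _ mu); last exact: (can_inj muK).
    apply: subset_leq_card; apply/subsetP => _ /imsetP[v vm ->].
    move: vm; rewrite !inE => /and3P[/eqP pv Zv muv].
    have Zmu : Z0 (mu v) by rewrite /Z0 inv_conn_mu.
    rewrite muK [v == _]eq_sym muv Zmu andbT.
    case: (pal_pairingP v) => [[_ [-> _]]|[_ E]]; first by rewrite pv eqxx.
    by rewrite -/mu in E; rewrite E eqxx in muv.
  have mE : #|m U| = #|m (t U)|.
    by apply/eqP; rewrite eqn_leq mle /= -{2}(tperm_imsetK a b U) mle.
  have c0 : cnt s U = g U + #|[set v in F U | ~~ Z0 v]|.
    rewrite /cnt -(cardsID [set v | Z0 v]); congr (_ + _);
      by apply: eq_card => v; rewrite !inE // andbC.
  have c1 : cnt s' U = g (t U) + #|[set v in F U | ~~ Z0 v]|.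
    rewrite /cnt -(cardsID [set v | Z0 v]); congr (_ + _);
      apply: eq_card => v; rewrite !inE palE; case: (Z0 v); rewrite ?andbF ?andbT //.
    by rewrite (can2_eq (tperm_imsetK a b) (tperm_imsetK a b)).
  rewrite c0 c1 !gE mE !(can2_eq (tperm_imsetK a b) (tperm_imsetK a b)).
  by rewrite [LHS]addnAC [RHS]addnAC; nat_lia.
Qed.

End Swap.

Definition cnt_weight s : nat := \sum_(U : {set C}) cnt s U ^ 2.

Definition balanced s : Prop :=
  coloring e s /\ forall s', coloring e s' -> cnt_weight s <= cnt_weight s'.

(** If [Y] is not [S], the weight changes by (2 - 2g) + (2 - 2g'), where g and g' are the positive
    gaps at [S] and [Y]; minimality forces g = g' = 1. If [Y = S], it changes by 8 - 4g with g >= 2,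
    which forces g = 2. In both cases the multiplicities are merely permuted, so the new colouring
    is balanced again. *)
Lemma balanced_swap s a b S (t := fun U : {set C} => tperm a b @: U) :
  balanced s -> cnt s (t S) < cnt s S ->
  exists2 s', balanced s' &
  [/\ cnt s' S = cnt s (t S), cnt s' (t S) = cnt s S &
   (cnt s S = cnt s (t S) + 2 /\
      forall U, U \notin [:: S; t S] -> cnt s' U = cnt s U) \/
   (cnt s S = cnt s (t S) + 1 /\
     exists Y, [/\ cnt s Y = cnt s (t Y) + 1, cnt s' Y = cnt s (t Y),
       cnt s' (t Y) = cnt s Y &
       forall U, U \notin [:: S; t S; Y; t Y] -> cnt s' U = cnt s U])].
Proof.
move=> [es smin] ltS.
have [s' [Y [es' ltY YS E]]] := cnt_swap es ltS.
rewrite -/(t S) in ltS YS E; rewrite -/(t Y) in ltY E.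
have tK : involutive t := tperm_imsetK a b.
have nS : t S != S by apply: contraTneq ltS => ->; rewrite ltnn.
have nY : t Y != Y by apply: contraTneq ltY => ->; rewrite ltnn.
have bal : cnt_weight s' = cnt_weight s -> balanced s'.
  by move=> Ew; split=> // s2 es2; rewrite Ew; apply: smin.
have [YE|YnS] := eqVneq Y S.
  move: (YS YE) E; rewrite YE => {}YS E.
  have ES := E S; have EtS := E (t S).
  rewrite !eqxx eq_sym (negPf nS) in ES; rewrite !eqxx (negPf nS) in EtS.
  have EO U : U \notin [:: S; t S] -> cnt s' U = cnt s U.
    by rewrite !inE negb_or => /andP[/negPf h1 /negPf h2]; have := E U; rewrite h1 h2; nat_lia.
  have ul : uniq [:: S; t S] by rewrite /= inE eq_sym nS.
  have w1 := sum_split_seq (fun U => cnt s U ^ 2) ul.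
  have w2 := sum_split_seq (fun U => cnt s' U ^ 2) ul.
  rewrite -/(cnt_weight s) !big_cons big_nil in w1.
  rewrite -/(cnt_weight s') !big_cons big_nil in w2.
  rewrite (eq_bigr (fun U => cnt s U ^ 2)) in w2; last by move=> U /EO ->.
  move: (\sum_(U | U \notin _) cnt s U ^ 2) w1 w2 => R w1 w2.
  have := smin s' es'; rewrite w1 w2 => le.
  have e1 : cnt s S = (cnt s' S).+2 by nat_lia.
  have e2 : cnt s' (t S) = (cnt s (t S)).+2 by nat_lia.
  have D : cnt s' S = cnt s (t S).
    by move: le YS; rewrite e1 e2 -!mulnn; nat_lia.
  exists s'; last by split; [nat_lia|nat_lia|left; split=> //; nat_lia].
  by apply: bal; rewrite w1 w2 e1 e2 D; nat_lia.
have YntS : Y != t S by apply: contraTneq ltY => ->; rewrite tK; nat_lia.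
have tYnS : t Y != S by rewrite (inv_eq tK).
have tYntS : t Y != t S by rewrite (inj_eq (can_inj tK)).
have ES := E S; have EtS := E (t S); have EY := E Y; have EtY := E (t Y).
rewrite !eqxx [S == t S]eq_sym [S == Y]eq_sym [S == t Y]eq_sym
  (negPf nS) (negPf YnS) (negPf tYnS) in ES.
rewrite !eqxx (negPf nS) [t S == Y]eq_sym [t S == t Y]eq_sym
  (negPf YntS) (negPf tYntS) in EtS.
rewrite !eqxx (negPf YnS) (negPf YntS) [Y == t Y]eq_sym (negPf nY) in EY.
rewrite !eqxx (negPf nY) (negPf tYnS) (negPf tYntS) in EtY.
have EO U : U \notin [:: S; t S; Y; t Y] -> cnt s' U = cnt s U.
  rewrite !inE !negb_or => /and4P[/negPf h1 /negPf h2 /negPf h3 /negPf h4].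
  by have := E U; rewrite h1 h2 h3 h4; nat_lia.
have ul : uniq [:: S; t S; Y; t Y].
  rewrite /= !inE !negb_or eq_sym nS [S == Y]eq_sym YnS [S == t Y]eq_sym tYnS.
  by rewrite [t S == Y]eq_sym YntS [t S == t Y]eq_sym tYntS eq_sym nY.
have w1 := sum_split_seq (fun U => cnt s U ^ 2) ul.
have w2 := sum_split_seq (fun U => cnt s' U ^ 2) ul.
rewrite -/(cnt_weight s) !big_cons big_nil in w1.
rewrite -/(cnt_weight s') !big_cons big_nil in w2.
rewrite (eq_bigr (fun U => cnt s U ^ 2)) in w2; last by move=> U /EO ->.
move: (\sum_(U | U \notin _) cnt s U ^ 2) w1 w2 => R w1 w2.
have := smin s' es'; rewrite w1 w2 => le.
have [D D'] : cnt s S = cnt s (t S) + 1 /\ cnt s Y = cnt s (t Y) + 1.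
  have e1 : cnt s S = (cnt s' S).+1 by nat_lia.
  have e2 : cnt s' (t S) = (cnt s (t S)).+1 by nat_lia.
  have e3 : cnt s Y = (cnt s' Y).+1 by nat_lia.
  have e4 : cnt s' (t Y) = (cnt s (t Y)).+1 by nat_lia.
  by move: le; rewrite e1 e2 e3 e4 -!mulnn; nat_lia.
exists s'.
  have e1 : cnt s' S = cnt s (t S) by nat_lia.
  have e2 : cnt s' (t S) = cnt s S by nat_lia.
  have e3 : cnt s' Y = cnt s (t Y) by nat_lia.
  have e4 : cnt s' (t Y) = cnt s Y by nat_lia.
  by apply: bal; rewrite w1 w2 e1 e2 e3 e4; nat_lia.
split; [nat_lia|nat_lia|right; split=> //].
by exists Y; split=> //; nat_lia.
Qed.

(* Minimality of the weight excludes a gap of 3 between palettes that differ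
   in one colour.  A gap of 3 at distance [r] is moved to distance [r - 1]
   by a swap, unless all palettes next to the top one have gap 2, all those
   next to the bottom one have gap 1; then a swap at a place in between where
   the gap drops from 2 to 1 moves that drop towards the top. *)
Lemma balanced_gap r s S T : balanced s -> #|S| = #|T| -> #|S :\: T| = r ->
  cnt s S <= cnt s T + 2.
Proof.
elim/ltn_ind: r s S T => r IHr s S T bs cST rST.
rewrite leqNgt; apply/negP; rewrite addn2 => gap.
pose viol s S T := [/\ balanced s, #|S| = #|T|, #|S :\: T| = r & cnt s T + 3 <= cnt s S].
have closer s0 S0 T0 : balanced s0 -> #|S0| = #|T0| -> #|S0 :\: T0| < r ->
    cnt s0 S0 <= cnt s0 T0 + 2.
  by move=> b0 c0 lt; apply: (IHr _ lt).
(* The drop from [S0] to its neighbour is 1 or 2. A drop of 2 could be exchanged alone, leaving [T0]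
   untouched and carrying the large multiplicity one step closer to it, against [closer]. *)
have top s0 S0 T0 a b : viol s0 S0 T0 -> a \in S0 :\: T0 -> b \in T0 :\: S0 ->
    cnt s0 S0 = cnt s0 T0 + 3 /\ cnt s0 (tperm a b @: S0) = cnt s0 T0 + 2.
  move=> [b0 c0 r0 g0]; rewrite !inE => /andP[aT aS] /andP[bS bT].
  have rU := tperm_setDl aS bS bT aT; rewrite r0 in rU.
  set U := tperm a b @: S0 in rU *.
  have cU : #|U| = #|T0| by rewrite card_tperm_imset.
  have leU : cnt s0 U <= cnt s0 T0 + 2 by apply: closer => //; rewrite rU.
  have ltU : cnt s0 U < cnt s0 S0 by nat_lia.
  have [s1 b1 [e1 e2 []]] := balanced_swap b0 ltU; last first.
    by rewrite -/U => -[D _]; nat_lia.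
  rewrite -/U => -[D EO].
  have [UT|UT] := eqVneq U T0; first by rewrite UT in D; nat_lia.
  have : cnt s1 U <= cnt s1 T0 + 2 by apply: closer => //; rewrite rU.
  rewrite -/U in e2; rewrite e2 EO; first nat_lia.
  rewrite !inE negb_or eq_sym [T0 == U]eq_sym UT andbT.
  by apply: contraNneq bS => ->.
have bottom s0 S0 T0 a b : viol s0 S0 T0 -> a \in S0 :\: T0 -> b \in T0 :\: S0 ->
    cnt s0 (tperm a b @: T0) = cnt s0 T0 + 1.
  move=> v0 aD bD; have [b0 c0 r0 g0] := v0; have [D3 _] := top _ _ _ _ _ v0 aD bD.
  move: aD bD; rewrite !inE => /andP[aT aS] /andP[bS bT].
  have rU := tperm_setDr aS bS bT aT; rewrite r0 in rU.
  set U := tperm a b @: T0 in rU *.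
  have cU : #|U| = #|T0| by rewrite card_tperm_imset.
  have leU : cnt s0 S0 <= cnt s0 U + 2 by apply: closer; rewrite // ?rU // cU.
  have tU : tperm a b @: U = T0 by rewrite /U tperm_imsetK.
  have ltU : cnt s0 (tperm a b @: U) < cnt s0 U by rewrite tU; nat_lia.
  have [s1 b1 [e1 e2 []]] := balanced_swap b0 ltU; rewrite tU in e1 e2 *; last first.
    by case.
  move=> [D EO].
  have [SU|SU] := eqVneq S0 U; first by rewrite -SU in D; nat_lia.
  have : cnt s1 S0 <= cnt s1 U + 2 by apply: closer; rewrite // ?rU // cU.
  rewrite e1 EO; first nat_lia.
  rewrite !inE negb_or SU /=.
  by apply: contraNneq bS => ->.
(* Quantified over the colouring as well, because the induction hypothesis is applied again after a
   swap. *)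
have inner i : 0 < i < r -> forall s0 S0 T0 A, viol s0 S0 T0 ->
    S0 :&: T0 \subset A -> A \subset S0 :|: T0 -> #|A| = #|S0| ->
    #|S0 :\: A| = i -> cnt s0 T0 + 2 <= cnt s0 A.
  elim: i => // i IHi /andP[_ ir] s0 S0 T0 A v0 lo hi cA iA.
  have [b0 c0 r0 g0] := v0.
  rewrite leqNgt; apply/negP => lt.
  have /card_gt0P[a aD] : 0 < #|S0 :\: A| by rewrite iA.
  have AS : #|A :\: S0| = i.+1.
    by have := cardsID A S0; have := cardsID S0 A; rewrite setIC; nat_lia.
  have /card_gt0P[b bD] : 0 < #|A :\: S0| by rewrite AS.
  move: aD bD; rewrite !inE => /andP[aA aS] /andP[bS bA].
  have aT : a \notin T0.
    by apply: contra aA => aT; apply: (subsetP lo); rewrite inE aS.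
  have bT : b \in T0 by have := subsetP hi b bA; rewrite inE (negPf bS).
  have aD : a \in S0 :\: T0 by rewrite inE aT.
  have bD : b \in T0 :\: S0 by rewrite inE bS.
  have [D3 D2] := top _ _ _ _ _ v0 aD bD; have D1 := bottom _ _ _ _ _ v0 aD bD.
  pose B := tperm a b @: A.
  have tB : tperm a b @: B = A by rewrite /B tperm_imsetK.
  have iB := tperm_setDr aS bS bA aA; rewrite iA -/B in iB; case: iB => iB.
  have cB : #|B| = #|S0| by rewrite card_tperm_imset.
  have [i0|i0] := posnP i.
    have BS : B = S0.
      apply/esym/eqP; rewrite eqEcard cB leqnn andbT -setD_eq0 -cards_eq0.
      by rewrite -iB i0.
    by move: D2; rewrite -BS tB; nat_lia.
  have loB : S0 :&: T0 \subset B.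
    apply/subsetP => c /[dup] /(subsetP lo) cA' ; rewrite inE => /andP[cS cT].
    rewrite mem_tperm_imset tpermD //; [by apply: contraTneq cT => <-|].
    by apply: contraTneq cS => <-.
  have hiB : B \subset S0 :|: T0.
    apply/subsetP => c; rewrite mem_tperm_imset; case: tpermP => [->|->|_ _] cA'.
    - by rewrite inE aS.
    - by rewrite inE bT orbT.
    - exact: (subsetP hi).
  have btw := card_between loB hiB.
  have gB : cnt s0 T0 + 2 <= cnt s0 B.
    by apply: (IHi _ s0 S0) => //; rewrite i0 /= ltnW.
  have lB : #|B :\: T0| < r by rewrite -r0 -btw -iB -addn1 leq_add2l.
  have leB := closer s0 B T0 b0 (etrans cB c0) lB.
  have lA : #|S0 :\: A| < r by rewrite iA.
  have leA := closer s0 S0 A b0 (esym cA) lA.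
  have ltB : cnt s0 (tperm a b @: B) < cnt s0 B by rewrite tB; nat_lia.
  have [s1 b1 [e1 e2 []]] := balanced_swap b0 ltB; rewrite tB in e1 e2 *.
    by move=> [D _]; nat_lia.
  move=> [_ [Y [Y1 Y2 Y3 EO]]].
  have SB : S0 != B.
    by apply/eqP => E; move: iB; rewrite -E setDv cards0; nat_lia.
  have SA : S0 != A by apply: contraNneq bS => ->.
  have TA : T0 != A by apply/eqP => E; rewrite -E in leA; nat_lia.
  have TB : T0 != B by apply/eqP => E; rewrite -E in gB; nat_lia.
  have TS : T0 != S0 by apply: contraNneq bS => <-.
  have tT : tperm a b @: (tperm a b @: T0) = T0 by rewrite tperm_imsetK.
  have tS : tperm a b @: (tperm a b @: S0) = S0 by rewrite tperm_imsetK.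
  (* The swap also exchanges the multiplicities of a second pair [Y], [tperm a b @: Y]. If that pair
     involved [S0] or [T0], either [closer] or the direction of the gap at [Y] would be
     contradicted; so the violation persists while [B] has become too rare. *)
  have [YS|YS] := eqVneq Y S0.
    subst Y; have : cnt s1 (tperm a b @: S0) <= cnt s1 T0 + 2.
      apply: closer; rewrite // ?card_tperm_imset //.
      by have := tperm_setDl aS bS bT aT; nat_lia.
    have [E|E] := eqVneq (tperm a b @: S0) T0; first by rewrite E in D2; nat_lia.
    rewrite Y3 EO; first nat_lia.
    by rewrite !inE !negb_or TB TA TS [T0 == _]eq_sym E.
  have [tYS|tYS] := eqVneq (tperm a b @: Y) S0.
    have YE : Y = tperm a b @: S0 by rewrite -tYS tperm_imsetK.
    by move: Y1; rewrite tYS YE D2; nat_lia.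
  have keepS : cnt s1 S0 = cnt s0 S0.
    by apply: EO; rewrite !inE !negb_or SB SA ![S0 == _]eq_sym YS tYS.
  have [YT|YT] := eqVneq Y T0; first by move: Y1; rewrite YT D1; nat_lia.
  have [tYT|tYT] := eqVneq (tperm a b @: Y) T0.
    have YE : Y = tperm a b @: T0 by rewrite -tYT tperm_imsetK.
    have : cnt s1 S0 <= cnt s1 Y + 2.
      apply: closer; rewrite // ?YE ?card_tperm_imset //.
      by have := tperm_setDr aS bS bT aT; nat_lia.
    by rewrite Y2 tYT keepS; nat_lia.
  have keepT : cnt s1 T0 = cnt s0 T0.
    by apply: EO; rewrite !inE !negb_or TB TA ![T0 == _]eq_sym YT tYT.
  have : cnt s1 T0 + 2 <= cnt s1 B.
    apply: (IHi _ s1 S0) => //; first by rewrite i0 /= ltnW.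
    by split=> //; rewrite keepS keepT.
  by rewrite keepT e1; nat_lia.
have v0 : viol s S T by split=> //; nat_lia.
have TS : #|T :\: S| = r by have := cardsID S T; have := cardsID T S; rewrite setIC; nat_lia.
have r0 : 0 < r.
  rewrite lt0n; apply: contraTneq gap => r0.
  suff -> : S = T by nat_lia.
  by apply/eqP; rewrite eqEcard cST leqnn andbT -setD_eq0 -cards_eq0 rST r0.
have /card_gt0P[a aD] : 0 < #|S :\: T| by rewrite rST.
have /card_gt0P[b bD] : 0 < #|T :\: S| by rewrite TS.
have [D3 D2] := top _ _ _ _ _ v0 aD bD; have D1 := bottom _ _ _ _ _ v0 aD bD.
move: (aD) (bD); rewrite !inE => /andP[aT aS] /andP[bS bT].
have rU := tperm_setDr aS bS bT aT; rewrite rST in rU.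
have [r1|r1] := leqP r 1.
  have : tperm a b @: T = S.
    apply/esym/eqP; rewrite eqEcard card_tperm_imset cST leqnn andbT.
    by rewrite -setD_eq0 -cards_eq0; nat_lia.
  by move=> E; rewrite E in D1; nat_lia.
have : cnt s T + 2 <= cnt s (tperm a b @: T).
  apply: (inner r.-1 _ s S T) => //; [nat_lia| | | |nat_lia].
  - apply/subsetP => c; rewrite inE => /andP[cS cT].
    rewrite mem_tperm_imset tpermD //; [by apply: contraTneq cT => <-|].
    by apply: contraTneq cS => <-.
  - apply/subsetP => c; rewrite mem_tperm_imset; case: tpermP => [->|->|_ _] cA'.
    + by rewrite inE aS.
    + by rewrite inE bT orbT.
    + by rewrite inE cA' orbT.
  - by rewrite card_tperm_imset.
by rewrite D1; nat_lia.
Qed.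

Theorem balanced_coloring s : coloring e s ->
  exists2 s', coloring e s' &
    forall S T, #|S| = #|T| -> cnt s' S <= cnt s' T + 2.
Proof.
move=> es; have [s' [es' smin]] := exists_minimizer cnt_weight (ex_intro _ _ es).
by exists s' => // S T cST; apply: balanced_gap cST (erefl _).
Qed.

End Balance.

(** * Spanning linear forests without small components *)

Section RelDegree.
Variable V : finType.
Implicit Types (f h : rel V) (x y z : V).

Definition nbrs f x : {set V} := [set y | f x y].
Definition rdeg f x : nat := #|nbrs f x|.
Definition rsize f : nat := #|[set p : V * V | f p.1 p.2]|.

Definition del_edge f x y : rel V :=
  [rel u v | [&& f u v, (u, v) != (x, y) & (u, v) != (y, x)]].

Lemma del_edge_sym f x y : symmetric f -> symmetric (del_edge f x y).
Proof.
move=> fS u v; rewrite /del_edge /= fS; congr (_ && _).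
by rewrite !xpair_eqE andbC; congr (_ && _); rewrite andbC.
Qed.

Lemma del_edge_sub f x y u v : del_edge f x y u v -> f u v.
Proof. by case/andP. Qed.

Lemma nbrs_del_edge f x y z : symmetric f -> x != y ->
  nbrs (del_edge f x y) z =
  if z == x then nbrs f x :\ y else if z == y then nbrs f y :\ x else nbrs f z.
Proof.
move=> fS xy; apply/setP => u; rewrite inE /del_edge /= !xpair_eqE.
case: (eqVneq z x) => [->|zx] /=; first by rewrite (negPf xy) !inE andbT andbC.
case: (eqVneq z y) => [->|zy] /=; first by rewrite !inE andbC.
by rewrite !inE !andbT.
Qed.

Lemma rdeg_del_edge f x y z : symmetric f -> x != y -> f x y ->
  rdeg (del_edge f x y) z + ((z == x) || (z == y)) = rdeg f z.
Proof.
move=> fS xy fxy; rewrite /rdeg nbrs_del_edge //.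
case: (eqVneq z x) => [->|zx] /=; first by rewrite (cardsD1 y (nbrs f x)) inE fxy addnC.
case: (eqVneq z y) => [->|zy] /=; last by rewrite addn0.
by rewrite (cardsD1 x (nbrs f y)) inE fS fxy addnC.
Qed.

Lemma rsize_del_edge f x y : f x y -> rsize (del_edge f x y) < rsize f.
Proof.
move=> fxy; apply: proper_card; apply/properP; split.
  by apply/subsetP => p; rewrite !inE => /del_edge_sub.
by exists (x, y); rewrite !inE // /del_edge /= eqxx andbF.
Qed.

Lemma rdeg_gt0 f x y : f x y -> 0 < rdeg f x.
Proof. by move=> fxy; apply/card_gt0P; exists y; rewrite inE. Qed.

Lemma rdegS f h x : (forall u v, f u v -> h u v) -> rdeg f x <= rdeg h x.
Proof.
by move=> fh; apply: subset_leq_card; apply/subsetP => y; rewrite !inE; apply: fh.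
Qed.

End RelDegree.

Section Skeleton.
Variables (V : finType) (e : rel V) (d : nat).
Hypotheses (e_sym : symmetric e) (e_irr : irreflexive e).

(** Components are paths and cycles by the degree bound; the last clause excludes those consisting
    of a single edge. *)
Definition skeleton (h : rel V) : Prop :=
  [/\ symmetric h, forall x y, h x y -> e x y, forall x, 0 < rdeg h x <= 2 &
      forall x y, h x y -> 3 <= rdeg h x + rdeg h y].

(* Two colour classes of a (d+1)-edge colouring: the first is chosen maximum,
   and a Kempe change of the second against a third class makes sure that no
   edge of the first has both ends uncovered by the second. *)
Lemma exists_skeleton : 1 < d -> (forall v, rdeg e v = d) ->
  exists h, skeleton h.
Proof.
move=> d1 reg; pose C := 'I_d.+1.
pose c1 : C := ord0; pose c2 : C := inord 1; pose c3 : C := inord 2.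
have v2 : val c2 = 1 by rewrite /= inordK // ltnW.
have v3 : val c3 = 2 by rewrite /= inordK.
have c12 : c1 != c2 by rewrite -val_eqE v2.
have c13 : c1 != c3 by rewrite -val_eqE v3.
have c23 : c2 != c3 by rewrite -val_eqE v2 v3.
have exs : exists s : C -> V -> V, coloring e s.
  by apply: vizing => // v; rewrite card_ord ltnS -(reg v).
have [s [es smin]] := exists_minimizer (fun s : C -> V -> V => #|[set v | s c1 v == v]|) exs.
have [sK sE eS sU] := es.
have miss1 r (er : coloring e r) (a b : C) v : r a v = v -> r b v = v -> a = b.
  move=> av bv; have := cardsC (pal r v); rewrite (card_pal v e_irr er).
  rewrite -/(nbrs e v) -/(rdeg e v) reg => E.
  have /eqP/cards1P[c cE] : #|~: pal r v| = 1.
    by apply: (@addnI d); rewrite E addn1 card_ord.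
  have : a \in ~: pal r v by rewrite !inE av eqxx.
  have : b \in ~: pal r v by rewrite !inE bv eqxx.
  by rewrite cE !inE => /eqP -> /eqP ->.
(* Otherwise recolouring the edge uv with [c1] would enlarge the class [c1]. This excludes edges of
   the second class with both ends uncovered by the first. *)
have indep u v : e u v -> s c1 u = u -> s c1 v = v -> False.
  move=> uv su sv; have [b bE] := eS u v uv.
  have unv : u != v by apply: contraTneq uv => ->; rewrite e_irr.
  have bEv : s b v = u by rewrite -bE sK.
  have Z1 w : (s c1 w \in [set u; v]) = (w \in [set u; v]).
    by rewrite !inE !(inv_eq (sK c1)) su sv.
  have Zb w : (s b w \in [set u; v]) = (w \in [set u; v]).
    by rewrite !inE !(inv_eq (sK b)) bE bEv orbC.
  have := smin _ (kswap_coloring es Z1 Zb); rewrite leqNgt; case/negP.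
  apply: proper_card; apply/properP; split.
    apply/subsetP => w; rewrite !inE /kswap tpermL; case: ifP => // /set2P[]->.
      by rewrite su.
    by rewrite sv.
  exists u; first by rewrite inE su.
  rewrite inE /kswap tpermL; case: ifP => [_|/negP[]]; last exact: set21.
  by rewrite bE eq_sym.
pose W := one_fixed (s c2) (s c3); pose tau := chain_end (s c2) (s c3).
have tauN v : W v -> tau v != v by case/(chain_endP (sK c2) (sK c3)).
have Wtau v : W v -> W (tau v) by case/(chain_endP (sK c2) (sK c3)).
have tauK v : W v -> tau (tau v) = v by apply: chain_endK.
pose tau' v := if W v then tau v else v.
have tauW v : W (tau' v) = W v.
  by rewrite /tau'; case: (boolP (W v)) => Wv; [apply: Wtau|apply/negbTE].
have tau'K : involutive tau'.
  by move=> v; rewrite {1}/tau' tauW; case: ifP => Wv; rewrite /tau' Wv ?tauK.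
pose nu v := if W v && W (s c1 v) then s c1 v else v.
have nuK : involutive nu.
  move=> v; rewrite /nu; case: (boolP (W v && W (s c1 v))) => E.
    by rewrite sK andbC E.
  by rewrite (negPf E).
have [sg sgP] := involutions_bicoloring tau'K nuK.
pose miss v := s c2 v == v.
(* [F] tells which c2/c3-chains to exchange. If both ends miss the same colour, the choice makes
   them miss [c3]. Otherwise exactly one end misses [c2] either way, and it is arranged to be the
   one where [sg] is true. Since [sg] alternates along the [c1]-edges inside [W], no such edge has
   both ends missing [c2]. *)
pose F v := if miss v == miss (tau v) then miss v else miss v != sg v.
have Ft v : W v -> F (tau v) = F v.
  move=> Wv; have [+ _] := sgP v.
  rewrite /tau' Wv => /(_ (tauN v Wv)) E; rewrite /F tauK // E eq_sym.
  by case: (miss v); case: (miss (tau v)); case: (sg v).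
pose Z := chain_union (s c2) (s c3) F.
have ZE v : W v -> Z v = F v by move=> Wv; apply: chain_unionE.
pose r := kswap s c2 c3 Z.
have er : coloring e r.
  apply: kswap_coloring => // v; [exact: chain_union_kap|exact: chain_union_mu].
have [rK rE eR rU] := er.
have r1 v : r c1 v = s c1 v by rewrite /r kswap_other.
have key v : r c2 v = v -> W v /\ sg v.
  rewrite /r /kswap tpermL; case: ifP => Zv sv.
    have m2 : miss v = false.
      by apply/negbTE/eqP => /(miss1 s es _ _ _ sv) /esym; apply/eqP.
    have Wv : W v by rewrite /W /one_fixed sv eqxx addbT -/(miss v) m2.
    by split=> //; move: Zv; rewrite ZE // /F m2; case: (miss _); case: (sg v).
  have m3 : s c3 v == v = false.
    by apply/negbTE/eqP => /(miss1 s es _ _ _ sv); apply/eqP.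
  have Wv : W v by rewrite /W /one_fixed sv eqxx m3.
  split=> //; move: Zv; rewrite ZE // /F /miss sv eqxx.
  by case: (s c2 _ == _); case: (sg v).
pose h : rel V := [rel x y | (x != y) && ((r c1 x == y) || (r c2 x == y))].
have h_sym : symmetric h.
  have rS c x y : (r c x == y) = (r c y == x) by rewrite (inv_eq (rK c)) eq_sym.
  by move=> x y; rewrite /h /= [x == y]eq_sym (rS c1 x) (rS c2 x).
have degE x : rdeg h x = (r c1 x != x) + (r c2 x != x).
  have E : nbrs h x = [set r c1 x; r c2 x] :\ x.
    apply/setP => y; rewrite !inE /h /= [x == y]eq_sym.
    by rewrite [r c1 x == y]eq_sym [r c2 x == y]eq_sym.
  have := cardsD1 x [set r c1 x; r c2 x]; rewrite /rdeg E cards2 !inE.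
  have : r c1 x = r c2 x -> r c1 x == x.
    by move=> E12; apply/negPn/negP => /(rU _ _ _ E12); apply/eqP.
  case: (eqVneq (r c1 x) x) => [->|n1]; case: (eqVneq (r c2 x) x) => [->|n2] //=.
  - by move=> _; nat_lia.
  - by move=> _; nat_lia.
  - by rewrite n1 => _; nat_lia.
  - move=> H; have /negPf -> : r c1 x != r c2 x by apply/eqP => /H.
    by nat_lia.
have deg_gt0 x : 0 < rdeg h x.
  rewrite degE; case: (eqVneq (r c1 x) x) => // E1; case: (eqVneq (r c2 x) x) => // E2.
  by case/eqP: c12; apply: miss1 er _ _ _ E1 E2.
exists h; split=> //.
- move=> x y /andP[xy /orP[]/eqP E]; rewrite -E; apply: rE; by rewrite E eq_sym.
- by move=> x; rewrite deg_gt0 degE; do 2 case: (_ != _).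
- move=> x y /andP[xy]; rewrite !degE => /orP[]/eqP E.
  + have Ey : r c1 y = x by rewrite -E rK.
    rewrite E Ey [y == x]eq_sym xy.
    case: (eqVneq (r c2 x) x) => [/key[Wx sx]|_]; last by case: (_ != _).
    case: (eqVneq (r c2 y) y) => [/key[Wy sy]|_] //.
    have [_] := sgP x; rewrite /nu -r1 E Wx Wy [y == x]eq_sym xy sx sy.
    by move/(_ isT).
  + have Ey : r c2 y = x by rewrite -E rK.
    rewrite E Ey [y == x]eq_sym xy.
    case: (eqVneq (r c1 x) x) => [x1|_]; last by case: (_ != _).
    case: (eqVneq (r c1 y) y) => [y1|_] //.
    case: (indep x y); rewrite -?r1 //.
    by rewrite -E; apply: rE; rewrite E eq_sym.
Qed.

Definition min_skeleton (h : rel V) : Prop :=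
  skeleton h /\ forall h', skeleton h' -> rsize h <= rsize h'.

Lemma exists_min_skeleton : 1 < d -> (forall v, rdeg e v = d) ->
  exists h, min_skeleton h.
Proof. by move=> d1 reg; apply: exists_minimizer; apply: exists_skeleton. Qed.

Variable h : rel V.
Hypothesis minh : min_skeleton h.

Lemma skeleton_irr : irreflexive h.
Proof.
by case: minh => -[_ he _ _] _ x; apply: contraFF (e_irr x); apply: he.
Qed.

(** Acyclicity, in the form used by an induction that removes pendant edges. A nonempty leafless [f]
    would be a union of cycles that are components of [h]; opening one of them leaves a path with at
    least three vertices, hence a smaller skeleton. *)
Lemma min_skeleton_leaf (f : rel V) x y : symmetric f ->
  (forall u v, f u v -> h u v) -> f x y -> exists z, rdeg f z = 1.
Proof.
move=> fS fh fxy; apply: contrapT => noleaf.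
have [[hS he h12 h3] hmin] := minh.
have xy : x != y by apply: contraTneq (fh _ _ fxy) => ->; rewrite skeleton_irr.
have hxy := fh _ _ fxy.
have full u v : f u v -> nbrs f u = nbrs h u /\ rdeg h u = 2.
  move=> fuv; have := rdeg_gt0 fuv; have le := rdegS u fh.
  have /andP[_ h2] := h12 u; have n1 : rdeg f u <> 1 by move=> E; apply: noleaf; exists u.
  move=> f0; have f2 : rdeg f u = 2 by lia.
  have hu2 : rdeg h u = 2 by lia.
  split=> //; apply/eqP; rewrite eqEcard -/(rdeg h u) -/(rdeg f u) f2 hu2 leqnn andbT.
  by apply/subsetP => w; rewrite !inE; apply: fh.
have degx : rdeg h x = 2 by have [] := full _ _ fxy.
have degy : rdeg h y = 2 by have [] := full y x; rewrite // fS.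
pose h' := del_edge h x y.
have degE z := rdeg_del_edge z hS xy hxy.
have side z w : (z == x) || (z == y) -> h' z w -> rdeg h' z + rdeg h' w = 3.
  move=> zxy h'zw; have hzw := del_edge_sub h'zw.
  have [fz dz] : nbrs f z = nbrs h z /\ rdeg h z = 2.
    by case/orP: zxy => /eqP ->; [apply: full fxy|apply: (full y x); rewrite fS].
  have fzw : f z w by move/setP/(_ w): fz; rewrite !inE hzw.
  have [_ dw] : nbrs f w = nbrs h w /\ rdeg h w = 2 by apply: (full w z); rewrite fS.
  have /negPf wxy : ~~ ((w == x) || (w == y)).
    have zw : z != w by apply: contraTneq hzw => ->; rewrite skeleton_irr.
    move: h'zw zw; rewrite /h' /del_edge /= !xpair_eqE !negb_and => /and3P[_].
    case/orP: (zxy) => /eqP ->; rewrite eqxx /=.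
      by move=> wy _ xw; rewrite negb_or eq_sym xw wy.
    by move=> _ wx yw; rewrite negb_or wx eq_sym yw.
  have := degE z; have := degE w; rewrite wxy zxy -/h'; lia.
have : skeleton h'.
  split; first exact: del_edge_sym.
  - by move=> u v /del_edge_sub/he.
  - move=> z; have := degE z; have := h12 z; rewrite -/h'.
    case: (eqVneq z x) => [->|_]; first by rewrite degx /=; lia.
    case: (eqVneq z y) => [->|_]; first by rewrite degy /=; lia.
    by rewrite /=; lia.
  - move=> u v huv; have [uxy|uxy] := boolP ((u == x) || (u == y)).
      by rewrite (side u v).
    have [vxy|vxy] := boolP ((v == x) || (v == y)).
      have hvu : h' v u by rewrite /h' del_edge_sym.
      by rewrite addnC (side v u).
    have := degE u; have := degE v; rewrite (negPf uxy) (negPf vxy) -/h'.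
    by have := h3 _ _ (del_edge_sub huv); lia.
by move/hmin; rewrite leqNgt rsize_del_edge.
Qed.

(** The neighbour of a vertex of degree 1 has degree 2, and a vertex of degree 2 serves at most two
    of them. *)
Lemma skeleton_card1 : 3 * #|[set x | rdeg h x == 1]| <= 2 * #|V|.
Proof.
have [[hS he h12 h3] _] := minh.
set D1 := [set x | rdeg h x == 1]; pose D2 := [set x | rdeg h x == 2].
have cV : #|D1| + #|D2| = #|V|.
  rewrite -cardsUI [X in _ + X](_ : _ = 0) ?addn0; last first.
    by apply: eq_card0 => x; rewrite !inE; case: eqP => // ->.
  apply: eq_card => x; rewrite !inE; have := h12 x; lia.
suff : #|D1| <= 2 * #|D2| by lia.
rewrite -sum1_card.
have step1 x : x \in D1 -> 1 <= \sum_(y in D2) h x y.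
  rewrite inE => /eqP x1; have /andP[/card_gt0P[y yx] _] := h12 x.
  have hxy : h x y by rewrite inE in yx.
  have y2 : y \in D2.
    rewrite inE; have := h3 _ _ hxy; have /andP[_] := h12 y; rewrite x1; lia.
  by rewrite (bigD1 y) //= hxy.
apply: (@leq_trans (\sum_(x in D1) \sum_(y in D2) h x y)); first exact: leq_sum.
rewrite exchange_big /= mulnC -sum_nat_const; apply: leq_sum => y.
rewrite inE => /eqP <-; rewrite /rdeg -sum1_card [X in _ <= X]big_mkcond [X in X <= _]big_mkcond /=.
by apply: leq_sum => x _; rewrite !inE hS; case: ifP => //; case: (h y x).
Qed.

End Skeleton.

(** * Colouring the linear forest with four colours *)

Section GreedyColoring.
Variables (V : finType) (T : eqType) (lab : V -> T) (h : rel V).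
Hypothesis h_irr : irreflexive h.
Hypotheses (h_gt0 : forall x, 0 < rdeg h x) (h_le2 : forall x, rdeg h x <= 2).
Hypothesis h_edge : forall x y, h x y -> 3 <= rdeg h x + rdeg h y.
Hypothesis h_leaf : forall (f : rel V) x y, symmetric f ->
  (forall u v, f u v -> h u v) -> f x y -> exists z, rdeg f z = 1.
Hypothesis lab_deg : forall x y, lab x = lab y -> rdeg h x = rdeg h y.
Hypothesis lab_two : forall x y z,
  y != x -> z != x -> lab y = lab x -> lab z = lab x -> y = z.
Implicit Types (f : rel V) (g : V -> V -> 'I_4).

Definition rpal f g (x : V) : {set 'I_4} := [set g x y | y in nbrs f x].

(* Only the vertices all of whose [h]-edges are in [f] are compared. *)
Definition good_coloring f g : Prop :=
  [/\ forall x y, g x y = g y x,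
      forall x y z, f x y -> f x z -> y != z -> g x y != g x z &
      forall x y, x != y -> lab x = lab y -> rdeg f x = rdeg h x ->
        rdeg f y = rdeg h y -> rpal f g x != rpal f g y].

Lemma card_completing (P Q : {set 'I_4}) :
  #|[set c | (c \notin P) && (c |: P == Q)]| <= 1.
Proof.
apply/card_le1_eqP => c c'; rewrite !inE => /andP[cP /eqP E] /andP[_ /eqP E'].
have : c \in Q by rewrite -E setU11.
by rewrite -E' !inE (negPf cP) orbF => /eqP.
Qed.

Lemma greedy_coloring f : symmetric f -> (forall u v, f u v -> h u v) ->
  exists g, good_coloring f g.
Proof.
move: {2}(rsize f) (leqnn (rsize f)) => n.
elim: n f => [|n IH] f fn f_sym fh.
  exists (fun _ _ => ord0); split=> // [x y z fxy|x y _ _ E].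
    have := rsize_del_edge fxy; lia.
  have := h_gt0 x; rewrite -E => /card_gt0P[z]; rewrite inE => fxz.
  by have := rsize_del_edge fxz; lia.
have [[x0 [y0 fxy0]]|nof] := EM (exists x y, f x y); last first.
  exists (fun _ _ => ord0); split=> // [x y z fxy|x y _ _ E].
    by case: nof; exists x, y.
  have := h_gt0 x; rewrite -E => /card_gt0P[z]; rewrite inE => fxz.
  by case: nof; exists x, z.
have [x x1] := h_leaf f_sym fh fxy0.
have /cards1P[y xE] : #|nbrs f x| == 1 by apply/eqP.
have fx z : f x z = (z == y) by move/setP/(_ z): xE; rewrite !inE.
have fxy : f x y by rewrite fx.
have fyx : f y x by rewrite f_sym.
have xy : x != y by apply: contraTneq (fh _ _ fxy) => ->; rewrite h_irr.
pose f' := del_edge f x y.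
have f'_sym : symmetric f' by apply: del_edge_sym.
have f'h u v : f' u v -> h u v by move/del_edge_sub/fh.
have f'n : rsize f' <= n by rewrite -ltnS (leq_trans (rsize_del_edge fxy)).
have [g' [g'S g'P g'D]] := IH f' f'n f'_sym f'h.
have nbE z := nbrs_del_edge z f_sym xy.
have dgE z := rdeg_del_edge z f_sym xy fxy.
pose partner z := odflt z [pick w | (w != z) && (lab w == lab z)].
have partnerE z w : w != z -> lab w = lab z -> partner z = w.
  move=> wz lw; rewrite /partner; case: pickP => [t /andP[tz /eqP lt]|/(_ w)].
    exact: lab_two tz wz lt lw.
  by rewrite wz lw eqxx.
pose P := rpal f' g' y.
have cP : #|P| <= 1.
  apply: leq_trans (leq_imset_card _ _) _.
  have := dgE y; rewrite eqxx orbT -/f' -/(rdeg f' y).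
  by have := rdegS y fh; have := h_le2 y; lia.
(* At most one colour each: that of the other edge at [y], the one completing [y] to the palette of
   its partner, and the one doing so for [x], whose palette before is empty since [x] is a leaf of
   [f]. *)
pose bad := P :|: [set c | (c \notin P) && (c |: P == rpal f' g' (partner y))]
  :|: [set c | (c \notin set0) && (c |: set0 == rpal f' g' (partner x))].
have [c cbad] : exists c, c \notin bad.
  apply: contrapT => no; have : #|'I_4| <= #|bad|.
    apply: subset_leq_card; apply/subsetP => c _; apply/negPn/negP => cb.
    by apply: no; exists c.
  rewrite card_ord leqNgt; case/negP; rewrite /bad.
  apply: leq_ltn_trans (leq_card_setU _ _) _.
  apply: leq_ltn_trans (leq_add (leq_card_setU _ _) (leqnn _)) _.
  have := card_completing P (rpal f' g' (partner y)).
  have := card_completing set0 (rpal f' g' (partner x)).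
  by lia.
move: cbad; rewrite /bad !in_setU !negb_or => /andP[/andP[cnP]].
rewrite !inE cnP setU0 /= => cy cx.
pose g u v := if ((u, v) == (x, y)) || ((u, v) == (y, x)) then c else g' u v.
have gxy : g x y = c by rewrite /g eqxx.
have gyx : g y x = c by rewrite /g eqxx orbT.
have gf' u v : f' u v -> g u v = g' u v.
  by rewrite /f' /del_edge /= /g => /and3P[_ /negPf -> /negPf ->].
have palx : rpal f g x = [set c].
  by rewrite /rpal xE imset_set1 gxy.
have paly : rpal f g y = c |: P.
  have E : nbrs f y = x |: nbrs f' y.
    by rewrite nbE eqxx eq_sym (negPf xy) setD1K // inE.
  rewrite {1}/rpal E imsetU1 gyx; congr (_ |: _); apply: eq_in_imset => z.
  by rewrite inE => /gf'.
have palz z : z != x -> z != y -> rpal f g z = rpal f' g' z.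
  move=> zx zy; have E : nbrs f z = nbrs f' z.
    by rewrite nbE (negPf zx) (negPf zy).
  by rewrite /rpal E; apply: eq_in_imset => w; rewrite inE => /gf'.
have mem_P z : f' y z -> g' y z \in P by move=> yz; apply/imset_f; rewrite inE.
exists g; split.
- move=> u v; rewrite /g g'S !xpair_eqE orbC.
  by rewrite [(v == x) && _]andbC [(v == y) && _]andbC.
- move=> u v w fuv fuw vw.
  have [ux|ux] := eqVneq u x.
    by move: fuv fuw vw; rewrite ux !fx => /eqP -> /eqP ->; rewrite eqxx.
  have [uy|uy] := eqVneq u y; last first.
    have fE t : f u t -> f' u t.
      by rewrite /f' /del_edge /= !xpair_eqE (negPf ux) (negPf uy) => ->.
    by rewrite !gf' ?fE //; apply: g'P; rewrite ?fE.
  have fE t : f u t -> t != x -> f' y t.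
    rewrite uy => fyt tx; rewrite /f' /del_edge /= fyt !xpair_eqE (negPf tx).
    by rewrite [y == x]eq_sym (negPf xy) eqxx.
  rewrite uy; have [vx|vx] := eqVneq v x.
    have wx : w != x by rewrite -vx eq_sym.
    rewrite vx gyx gf' ?fE //; apply: contraNneq cnP => ->; exact/mem_P/fE.
  have [wx|wx] := eqVneq w x.
    rewrite wx gyx gf' ?fE // eq_sym; apply: contraNneq cnP => ->; exact/mem_P/fE.
  by rewrite !gf' ?fE //; apply: g'P; rewrite ?fE.
(* The new edge changes the palettes of both [x] and [y], so these two must not be rivals. If [x] is
   complete it has degree 1 in [h], hence [y] has degree 2 and another label. *)
- have notxy : rdeg f x = rdeg h x -> lab x <> lab y.
    move=> fhx lxy; have := h_edge (fh _ _ fxy).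
    by rewrite -(lab_deg lxy) -fhx x1.
  have keyx w : w != x -> w != y -> lab w = lab x -> rpal f g x != rpal f g w.
    move=> wx wy lw; rewrite palx palz //; move: cx; rewrite (partnerE x w) //.
  have keyy w : w != x -> w != y -> lab w = lab y -> rpal f g y != rpal f g w.
    move=> wx wy lw; rewrite paly palz //; move: cy; rewrite (partnerE y w) //.
  move=> u v uv luv fu fv.
  have [ux|ux] := eqVneq u x.
    have vx : v != x by rewrite -ux eq_sym.
    rewrite ux; apply: keyx => //; last by rewrite -ux.
    by apply/eqP => vy; apply: notxy; rewrite -?ux -?vy.
  have [vx|vx] := eqVneq v x.
    rewrite vx eq_sym; apply: keyx => //; last by rewrite -vx.
    by apply/eqP => uy; apply: notxy; rewrite -?vx -?uy.
  have [uy|uy] := eqVneq u y.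
    rewrite uy; apply: keyy => //; last by rewrite -uy.
    by rewrite -uy eq_sym.
  have [vy|vy] := eqVneq v y.
    by rewrite vy eq_sym; apply: keyy => //; rewrite -vy.
  rewrite !palz //; apply: g'D => //; rewrite -/f'.
    by rewrite -fu -(dgE u) (negPf ux) (negPf uy) addn0.
  by rewrite -fv -(dgE v) (negPf vx) (negPf vy) addn0.
Qed.

End GreedyColoring.

(** * Binomial bounds and the final colouring *)

Lemma bin_pred_ge n m : n - m <= m.+1 -> 'C(n, m.+1) <= 'C(n, m).
Proof.
move=> le; rewrite -(leq_pmul2l (ltn0Sn m)) mul_bin_left.
by rewrite leq_mul2r le orbT.
Qed.

(** Induction in steps of 2, since d + 2 raises floor(3d/2) by exactly 3. Expanding C(m+3, d+2) by
    Pascal's rule gives at least 3 C(m, d) + C(m, d-1) >= 4 C(m, d), as d is past the middle of row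
    m. *)
Lemma exp2_le_bin d : 8 <= d -> 2 ^ d <= 'C((3 * d)./2, d).
Proof.
elim/ltn_ind: d => d IH d8.
have [d10|d10] := leqP 10 d; last first.
  have [->|->] : d = 8 \/ d = 9 by lia.
    by vm_compute.
  by vm_compute.
have [d' dE] : exists d', d = d'.+3 by exists (d - 3); lia.
have hE : (3 * d)./2 = ((3 * d'.+1)./2).+3.
  by rewrite dE (_ : 3 * d'.+3 = 3 * d'.+1 + 6) ?halfD /=; lia.
have := IH d'.+1; rewrite hE dE; set m := (3 * d'.+1)./2 => {}IH.
have mE : m - d' <= d'.+1 by rewrite /m; lia.
have := bin_pred_ge mE; have : 2 ^ d'.+1 <= 'C(m, d'.+1) by apply: IH; lia.
by rewrite !binS !expnS; lia.
Qed.

Section RegularBound.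
Variables (n d k : nat).
Hypotheses (d8 : 8 <= d) (n_ge : 256 <= n) (n_le : n <= 2 ^ d).
Hypotheses (nk : n <= 'C(k, d)) (k_le : k <= (3 * d)./2).

Lemma bound_k_gt : d < k.
Proof.
rewrite ltnNge; apply/negP => kd; move: nk; rewrite leqNgt; case/negP.
apply: leq_ltn_trans (_ : 1 < n); last by apply: leq_trans n_ge.
by move: kd; rewrite leq_eqVlt => /orP[/eqP->|/bin_small->]; rewrite ?binn.
Qed.

Lemma bound_diag : d * n <= k * 'C(k.-1, d.-1).
Proof.
rewrite mul_bin_diag prednK; last by apply: leq_trans d8.
by rewrite leq_mul2l nk orbT.
Qed.

Lemma bound_size1 m : 3 * m <= 2 * n -> m <= 'C(k.-1, d.-1).
Proof.
move=> mn; have := bound_diag; have := bound_k_gt.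
have k2 : 2 * k <= 3 * d by move: k_le; lia.
move: 'C(k.-1, d.-1) => c kd dn; rewrite -(@leq_pmul2l (3 * k)); last by lia.
by clear -mn k2 dn; nia.
Qed.

Lemma bound_size2 : n <= 'C(k.-1, d.-2).
Proof.
have kd := bound_k_gt; have k2 : 2 * k <= 3 * d by move: k_le; lia.
have := bound_diag.
have : d.-1 * 'C(k.-1, d.-1) = (k - d).+1 * 'C(k.-1, d.-2).
  have dE : d.-1 = d.-2.+1 by move: d8; lia.
  by rewrite dE mul_bin_left; congr (_ * _); move: d8 kd; lia.
(* The quotient C(k-1, d-2) / C(k, d) equals d(d-1) / (k(k-d+1)), which is at least 1 for d >= 9 but
   not for d = 8, k = 12 (56 < 60). There n <= 256 <= C(11, 6) = 462, whereas k <= 11 would give n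
   <= C(11, 8) = 165. *)
have [d9|d9] := leqP 9 d; last first.
  have d8' : d = 8 by lia.
  have n_le' := n_le; rewrite d8' in kd k2 n_le' *; move=> E D.
  have [k12|k12] := eqVneq k 12; last first.
    have k11 : k <= 11 by lia.
    have : 'C(k, 8) <= 'C(11, 8) by apply: leq_bin2l.
    move: nk; rewrite d8' => nk' le; have : n <= 165 by apply: leq_trans (leq_trans nk' le) _.
    by move: n_ge; lia.
  by rewrite k12; apply: leq_trans n_le' _.
move: 'C(k.-1, d.-1) 'C(k.-1, d.-2) => c1 c2 E D.
have kk : k * (k - d).+1 <= d * d.-1.
  have [j kE] : exists j, k = d + j by exists (k - d); lia.
  have [i dE] : exists i, d = i.+1 by exists d.-1; lia.
  by rewrite kE addKn dE /=; clear -k2 kE dE d9; nia.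
have pos : 0 < k * (k - d).+1 by rewrite muln_gt0; lia.
rewrite -(leq_pmul2l pos); apply: leq_trans (_ : d * d.-1 * n <= _).
  by rewrite leq_mul2r kk orbT.
rewrite -[X in _ <= X]mulnA -E [k * _]mulnCA [d * d.-1]mulnC.
by rewrite -[X in X <= _]mulnA leq_mul2l D orbT.
Qed.

End RegularBound.

Section RegularGraph.
Variables (G : sgraph) (d : nat).
Hypotheses (reg : Defs.regular G d) (G0 : 0 < #|G|).

Lemma kG_boundE k : kG_bound G k = (#|G| <= 'C(k, d)).
Proof.
have maxE : maxdeg G = d.
  rewrite /maxdeg; apply/eqP; rewrite eqn_leq; apply/andP; split.
    by apply/bigmax_leqP => v _; rewrite reg.
  by have /card_gt0P[v _] := G0; rewrite -(reg v); apply: leq_bigmax.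
have minE : mindeg G = d.
  rewrite /mindeg maxE; elim/big_ind: _ => // x y -> ->; exact: minnn.
rewrite /kG_bound minE maxE /index_iota subSnn /= andbT.
by congr (_ <= _); rewrite /ndeg; apply: eq_card => v; rewrite !inE reg eqxx.
Qed.

End RegularGraph.

(** If one palette of size [m] occurred three times, all others of that size would occur at least
    once, giving at least C(|C|, m) + 2 vertices. *)
Lemma cnt_le2 (V C : finType) (s : C -> V -> V) (m : nat) :
  (forall S T : {set C}, #|S| = #|T| -> cnt s S <= cnt s T + 2) ->
  #|[set v | #|pal s v| == m]| <= 'C(#|C|, m) ->
  forall S : {set C}, #|S| = m -> cnt s S <= 2.
Proof.
move=> bal le S Sm; rewrite leqNgt; apply/negP => S3.
move: le; rewrite leqNgt -card_draws; case/negP.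
set D := [set A : {set C} | #|A| == m].
have SD : S \in D by rewrite inE Sm.
have -> : #|[set v | #|pal s v| == m]| = \sum_(T in D) cnt s T.
  rewrite -sum1_card (partition_big (pal s) (fun T => T \in D)) /=; last first.
    by move=> v; rewrite !inE.
  apply: eq_bigr => T; rewrite inE => /eqP Tm; rewrite /cnt -sum1_card.
  apply: eq_bigl => v; rewrite !inE; apply/andP/eqP => [[_ /eqP]|E] //.
  by rewrite E Tm !eqxx.
rewrite (bigD1 S SD) /= (cardsD1 S) SD add1n.
have : #|D :\ S| <= \sum_(T in D | T != S) cnt s T.
  rewrite -sum1_card (eq_bigl (fun T => (T \in D) && (T != S))); last first.
    by move=> T; rewrite !inE andbC.
  apply: leq_sum => T /andP[]; rewrite inE => /eqP Tm _.
  have := bal S T; rewrite Sm Tm => /(_ erefl); lia.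
by move=> le; apply: leq_trans (leq_add S3 le); rewrite addSn add2n.
Qed.

(** * Assembling the vertex-distinguishing colouring *)

Lemma set2_eq (T : finType) (u v x y : T) : u != v -> [set u; v] = [set x; y] ->
  (x = u /\ y = v) \/ (x = v /\ y = u).
Proof.
move=> uv E; have := set21 u v; have := set22 u v; rewrite E !inE.
case/orP=> /eqP vE /orP[]/eqP uE; rewrite vE uE ?eqxx in uv *; by [|left|right].
Qed.

Lemma vd_colorable_intro (G : sgraph) m (x0 : G) (col : G -> G -> 'I_m) :
  (forall u v, adj u v -> col u v = col v u) ->
  (forall u v w, adj u v -> adj u w -> v != w -> col u v != col u w) ->
  (forall u v, u != v ->
    [set col u w | w in nbrs (@adj G) u] != [set col v w | w in nbrs (@adj G) v]) ->
  vd_colorable G m.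
Proof.
move=> colS colP colD.
pose c : {ffun {set G} -> 'I_m} := [ffun A : {set G} =>
  if [pick p : G * G | adj p.1 p.2 && (A == [set p.1; p.2])] is Some p
  then col p.1 p.2 else col x0 x0].
have cE u v : adj u v -> c [set u; v] = col u v.
  move=> uv; rewrite ffunE; case: pickP => [[x y] /= /andP[xy /eqP E]|/(_ (u, v))].
    have unv : u != v by apply: contraTneq uv => ->; rewrite adj_irr.
    by have [[-> ->]|[-> ->]] := set2_eq unv E; rewrite // colS // adj_sym.
  by rewrite /= uv eqxx.
have palE u : palette c u = [set col u w | w in nbrs (@adj G) u].
  apply/setP => i; apply/imsetP/imsetP => [[A /incidentP[w uw ->] ->]|[w]].
    by exists w; rewrite ?inE ?cE.
  rewrite inE => uw ->; exists [set u; w]; last by rewrite cE.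
  by apply/incidentP; exists w.
apply/existsP; exists c; apply/andP; split.
  apply/forall_inP => A AE; apply/forall_inP => B BE; apply/implyP.
  case/andP=> AB /set0Pn[w]; rewrite inE => /andP[wA wB].
  have /incidentP[u wu Au] : A \in incident w by rewrite inE AE.
  have /incidentP[v wv Bv] : B \in incident w by rewrite inE BE.
  rewrite Au Bv !cE //; apply: colP => //.
  by apply: contraNneq AB => uv; rewrite Au Bv uv.
by apply/forallP => u; apply/forallP => v; apply/implyP => uv; rewrite !palE colD.
Qed.

Lemma vd_colorable_regular (G : sgraph) (d k : nat) : Defs.regular G d ->
  1 < d -> d < k ->
  (forall m, 3 * m <= 2 * #|G| -> m <= 'C(k.-1, d.-1)) ->
  #|G| <= 'C(k.-1, d.-2) -> 0 < #|G| -> vd_colorable G (k.-1 + 4).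
Proof.
move=> reg d1 dk size1 size2 /card_gt0P[x0 _].
set K := k.-1; pose e := @adj G.
have e_sym : symmetric e := @adj_sym G.
have e_irr : irreflexive e := @adj_irr G.
have dK : d <= K by rewrite /K; lia.
have [h minh] := exists_min_skeleton e_sym e_irr d1 reg.
have [[hS he h12 h3] _] := minh; have h_irr := skeleton_irr e_irr minh.
have h_gt0 x : 0 < rdeg h x by case/andP: (h12 x).
have h_le2 x : rdeg h x <= 2 by case/andP: (h12 x).
pose e2 : rel G := [rel x y | e x y && ~~ h x y].
have e2_sym : symmetric e2 by move=> x y; rewrite /e2 /= e_sym hS.
have e2_irr : irreflexive e2 by move=> x; rewrite /e2 /= e_irr.
have degE x : rdeg e2 x + rdeg h x = d.
  rewrite -(reg x) /degree -(cardsID (nbrs h x) [set u | adj x u]) addnC.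
  congr (_ + _); apply: eq_card => y; rewrite !inE; last by rewrite andbC.
  by apply/idP/andP => [hxy|[]//]; split=> //; apply: he.
(* Each vertex has an edge in [h], so its degree in [e2] is at most d - 1 < [K], and Vizing's
   theorem applies with [K] colours. *)
have [s0 es0] : exists s : 'I_K -> G -> G, coloring e2 s.
  apply: vizing => // x; rewrite card_ord -/(nbrs e2 x) -/(rdeg e2 x).
  have := degE x; have := h_gt0 x; lia.
have [s es bal] := balanced_coloring es0.
have [sK sE eS sU] := es.
have cpal x : #|pal s x| + rdeg h x = d by rewrite (card_pal x e2_irr es) degE.
have le2 x : cnt s (pal s x) <= 2.
  have [x1|x2] : rdeg h x = 1 \/ rdeg h x = 2.
  - by have := h12 x; lia.
  - apply: (@cnt_le2 _ _ s d.-1) => //; last by have := cpal x; lia.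
    rewrite card_ord; apply: size1; apply: leq_trans (skeleton_card1 minh).
    rewrite leq_mul2l /=; apply: subset_leq_card; apply/subsetP => y.
    rewrite !inE => /eqP E; apply/eqP; have := cpal y; rewrite E; nat_lia.
  - apply: (@cnt_le2 _ _ s d.-2) => //; last by have := cpal x; lia.
    by rewrite card_ord; apply: leq_trans size2; apply: max_card.
have lab_deg x y : pal s x = pal s y -> rdeg h x = rdeg h y.
  by move=> E; have := cpal x; have := cpal y; rewrite E; lia.
have lab_two x y z : y != x -> z != x -> pal s y = pal s x -> pal s z = pal s x -> y = z.
  move=> yx zx py pz; apply/eqP/negPn/negP => yz.
  have := le2 x; rewrite leqNgt; case/negP.
  have <- : #|[set x; y; z]| = 3.
    by rewrite setUC cardsU1 cards2 !inE negb_or zx eq_sym yz eq_sym yx.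
  apply: subset_leq_card; apply/subsetP => w; rewrite !inE.
  by case/orP=> [/orP[]|] /eqP ->; rewrite ?py ?pz.
(* The label is the palette in G - h. Its size determines the degree in [h], and its multiplicity is
   at most 2: these are the two requirements on labels. *)
have [g [gS gP gD]] := greedy_coloring h_irr h_gt0 h_le2 h3
  (min_skeleton_leaf e_irr minh) lab_deg lab_two hS (fun u v huv => huv).
pose col u v : 'I_(K + 4) := if h u v then rshift K (g u v)
  else if [pick a | s a u == v] is Some a then lshift 4 a else rshift K ord0.
have colh u v : h u v -> col u v = rshift K (g u v) by rewrite /col => ->.
have cols a u : s a u != u -> col u (s a u) = lshift 4 a.
  move=> N; have := sE a u N; rewrite /e2 /= /col => /andP[_ /negPf ->].
  case: pickP => [b /eqP E|/(_ a)]; last by rewrite eqxx.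
  by rewrite (sU b a u) // E.
have adjP u v : e u v -> h u v \/ exists2 a, s a u != u & s a u = v.
  move=> uv; have [|nh] := boolP (h u v); first by left.
  have [|a E] := eS u v; first by rewrite /e2 /= uv nh.
  right; exists a => //; rewrite E.
  by apply: contraTneq uv => ->; rewrite e_irr.
apply: (@vd_colorable_intro G _ x0 col).
- move=> u v /adjP[huv|[a N <-]]; first by rewrite [RHS]colh 1?hS // colh // gS.
  by rewrite cols //; have := cols a (s a u); rewrite sK eq_sym => ->.
- move=> u v w /adjP[huv|[a N <-]] /adjP[huw|[b N' <-]] vw.
  + by rewrite !colh // eq_rshift gP.
  + by rewrite colh // cols // eq_rlshift.
  + by rewrite cols // colh // eq_lrshift.
  + by rewrite !cols // eq_lshift; apply: contra_neq vw => ->.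
- move=> u v uv; apply/eqP => E.
  have inl a w : (lshift 4 a \in [set col w t | t in nbrs e w]) = (a \in pal s w).
    rewrite inE; apply/imsetP/idP => [[t]|N].
      rewrite inE => /adjP[hwt|[b N <-]].
        by rewrite colh // => /eqP; rewrite eq_lrshift.
      by rewrite cols // => /eqP; rewrite eq_lshift => /eqP ->.
    by exists (s a w); rewrite ?cols // inE; have /andP[] := sE a w N.
  have inr c w : (rshift K c \in [set col w t | t in nbrs e w]) = (c \in rpal h g w).
    apply/imsetP/imsetP => [[t]|[t]].
      rewrite inE => /adjP[hwt|[b N <-]].
        by rewrite colh // => /eqP; rewrite eq_rshift => /eqP ->; exists t; rewrite ?inE.
      by rewrite cols // => /eqP; rewrite eq_rlshift.
    by rewrite inE => hwt ->; exists t; rewrite ?colh // inE he.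
  have pE : pal s u = pal s v by apply/setP => a; rewrite -!inl E.
  have := gD u v uv pE erefl erefl; case/eqP; apply/setP => c.
  by rewrite -!inr E.
Qed.

Section Log2.
Import GRing.Theory Num.Theory.
Local Open Scope ring_scope.

Lemma log2_exp2 (R : realType) d : log2 (2 ^+ d : R) = d%:R.
Proof.
by rewrite /log2 lnXn // -[ln 2 *+ d]mulr_natl mulfK // lt0r_neq0 // ln_gt0 // ltr1n.
Qed.

Lemma ler_log2 (R : realType) (x y : R) : 0 < x -> 0 < y ->
  (log2 x <= log2 y) = (x <= y).
Proof.
move=> x0 y0; rewrite /log2 ler_pM2r ?ler_ln ?posrE //.
by rewrite invr_gt0 ln_gt0 // ltr1n.
Qed.

Lemma log2_nat_le (R : realType) (n d : nat) : (0 < n)%N ->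
  (log2 (n%:R : R) <= d%:R) = (n <= 2 ^ d)%N.
Proof.
move=> n0; rewrite -(log2_exp2 R d) ler_log2 ?ltr0n ?exprn_gt0 //.
by rewrite -natrX ler_nat.
Qed.

Lemma log2_nat_ge (R : realType) (n d : nat) : (0 < n)%N ->
  (d%:R <= log2 (n%:R : R)) = (2 ^ d <= n)%N.
Proof.
move=> n0; rewrite -(log2_exp2 R d) ler_log2 ?ltr0n ?exprn_gt0 //.
by rewrite -natrX ler_nat.
Qed.

Lemma log2_0 (R : realType) : log2 (0 : R) = 0.
Proof. by rewrite /log2 ln0 // mul0r. Qed.

End Log2.

Theorem theorem1p3 (R : realType) (G : sgraph) (d : nat)
  (hreg : regular G d)
  (hd : (log2 (#|G|%:R : R) <= d%:R)%R)
  (hn : (8%:R <= log2 (#|G|%:R : R))%R) :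
  vd_index G <= kG G + 3.
Proof.
(* By convention the logarithm of 0 is 0, so the lower bound 8 excludes the empty graph. *)
have G0 : 0 < #|G|.
  rewrite lt0n; apply/eqP => E; move: hn.
  by rewrite E log2_0 Num.Theory.lern0.
move: hd hn; rewrite log2_nat_le // log2_nat_ge // => n_le n_ge.
have d8 : 8 <= d by rewrite -(@leq_exp2l 2) // (leq_trans n_ge).
have d1 : 1 < d by apply: leq_trans d8.
have adm := regular_admissible d1 hreg.
have [kb kmin] := kGP adm; rewrite (kG_boundE hreg G0) in kb.
have k_le : kG G <= (3 * d)./2.
  apply: kmin; rewrite (kG_boundE hreg G0).
  exact: leq_trans n_le (exp2_le_bin d8).
have dk := bound_k_gt n_ge kb.
have [_] := vd_indexP adm.
have -> : kG G + 3 = (kG G).-1 + 4 by lia.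
apply; apply: vd_colorable_regular hreg d1 dk _ _ G0.
  by move=> m; apply: (@bound_size1 #|G|).
by apply: (@bound_size2 #|G|).
Qed.
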